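(* Consider the ${\it Cox}(k)/M^Y/1$ queue described in the context ($1\le k<\infty$). It is ergodic if and only if $$\frac{1}{\sum_{i=0}^{k-1}\lambda_i^{-1}\prod_{l=0}^{i-1}q_l}=\frac{1}{\mathsf E\,C}<\mu\sum_{j=1}^{b}j\,p_j=\mu\,\mathsf E\,Y .$$ If this is the case, then its stationary distribution $\pi$ is given on levels $m\ge 1$ by $$\pi_{(m,i)}=\pi_{(0,0)}\,\frac{\lambda_0(1-\gamma)\gamma^{m-1}}{\mu(1-\phi_Y(\gamma))}\prod_{l=1}^{i}q_{l-1}\alpha_l,\qquad 0\le i\le k-1,$$ where $\gamma$ is the unique solution in $(0,1)$ of $\gamma=F(\gamma)$ with $$F(\gamma)=\frac{\lambda_0(1-q_0)+\sum_{i=1}^{k-1}\Big(\prod_{l=1}^{i}q_{l-1}\frac{\lambda_{l-1}}{\lambda_l+\mu-\mu\phi_Y(\gamma)}\Big)(1-q_i)\lambda_i+\gamma\mu\phi_Y(\gamma)}{\lambda_0+\mu},$$ and $$\alpha_i=\frac{\lambda_{i-1}}{\lambda_i+\mu-\mu\phi_Y(\gamma)},\qquad i=1,\ldots,k-1.$$ The boundary level is given by $$\pi_{(0,i)}=\pi_{(0,0)}\,\frac{\lambda_0}{\lambda_i}\prod_{s=0}^{i-1}q_s\left(1+\frac{(1-\gamma)\phi_Y(\gamma)}{\gamma(1-\phi_Y(\gamma))}\sum_{j=1}^{i}\prod_{l=1}^{j}\alpha_l\right),\qquad 1\le i\le k-1,$$ $$\pi_{(0,0)}=\left(\Big(1+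\frac{\lambda_0}{\mu(1-\phi_Y(\gamma))}\Big)\Big(1+\sum_{i=1}^{k-1}\frac{\lambda_0}{\lambda_i}\prod_{j=0}^{i-1}q_j\Big)\right)^{-1}.$$
   Context: ${\it Cox}(k)/M^Y/1$ queue. Inter-arrival times $C$ are i.i.d. Coxian of order $k$ with parameters $\lambda_0,\ldots,\lambda_{k-1}>0$ and $q_0,\ldots,q_{k-1}$, where $0<q_i\le 1$ for $i\le k-2$ and $q_{k-1}=0$: phase $i$ lasts an exponential time with parameter $\lambda_i$, at the end of which with probability $1-q_i$ a new customer arrives (and a new inter-arrival time starts in phase $0$), and with probability $q_i$ phase $i+1$ starts. There is a single server performing batch services: as long as the system is non-empty, services are completed at rate $\mu>0$; the batch size $Y$ is independent with $P\{Y=j\}=p_j$, $1\le j\le b$, $\sum_{j=1}^b p_j=1$, and $\min(Y,\text{number of customers present})$ customers leave. Write $\phi_Y(x)=\sum_{j=1}^b p_jx^j$. The queue is the Markov process on $\{(m,i): m\ge 0,\ 0\le i\le k-1\}$, where $m$ (the level) is the number of customers in the system and $i$ the number of completed phases of the current inter-arrival time. Its transitions are: from $(m,i)$ to $(m,i+1)$ at rate $q_i\lambda_i$ (for $i\le k-2$); from $(m,i)$ to $(m+1,0)$ at rate $(1-q_i)\lambda_i$; from $(m,i)$ with $m\ge 1$ to $(m-j,i)$ at rate $\mu p_j$ for $1\le j<m$, $j\le b$, and to $(0,i)$ at rate $\mu\sum_{j\ge m}p_j$. Empty products equal $1$ and empty sums equal $0$.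
   Formalization: In the formula for π_(0,i), the factor (1-γ)φ_Y(γ)/(γ(1-φ_Y(γ))) before the sum over j is replaced by 1, as the balance equations require; the printed factor is false whenever k≥2 and P(Y≥2)>0. *)

(* Defs.v *)
From HB Require Import structures.
From mathcomp Require Import all_boot all_order all_algebra.
From mathcomp Require Import all_classical all_reals all_analysis.

Set Implicit Arguments.
Unset Strict Implicit.
Unset Printing Implicit Defensive.

Import Order.TTheory GRing.Theory Num.Theory.
Import numFieldNormedType.Exports.

Local Open Scope classical_set_scope.
Local Open Scope ring_scope.

Section MarkovJumpProcess.
Context {R : realType} {S : choiceType}.

(* [rate x y] is the transition rate from x to y, for y != x; the diagonal is
   never used. *)
Implicit Types (rate : S -> S -> R) (x y : S).

Definition exit_rate rate x : R :=
  fine (esum [set~ x] (fun y => (rate x y)%:E)).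

Definition jump_prob rate x y : R :=
  if y == x then 0 else rate x y / exit_rate rate x.

Section Paths.
Context {d : measure_display} {T : measurableType d}.

(* Jump chain / holding time description of a continuous-time Markov chain
   without absorbing states: [Y n] is the state after n jumps and [H n] the time
   spent there.  The last clause is the joint law when started in x0: [Y] is a
   Markov chain with matrix [jump_prob rate] and, given [Y], the [H n] are
   independent and exponential with parameters [exit_rate rate (Y n)]. *)
Definition markov_jump_process rate (P : probability T R)
    (Y : nat -> T -> S) (H : nat -> T -> R) (x0 : S) : Prop :=
  [/\ forall n x, measurable (Y n @^-1` [set x]),
      forall n, measurable_fun setT (H n),
      forall n w, 0 < H n w
    & forall (n : nat) (x : nat -> S) (t : nat -> R),
        (forall i, 0 <= t i) ->
        P [set w | forall i, (i <= n)%N -> Y i w = x i /\ t i < H i w] =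
        ((x 0%N == x0)%:R * \prod_(i < n) jump_prob rate (x i) (x i.+1)
         * \prod_(i < n.+1) expR (- (exit_rate rate (x i) * t i)))%:E].

(* Time of the first jump into x; [ereal_inf set0 = +oo] if there is none. *)
Definition return_time (Y : nat -> T -> S) (H : nat -> T -> R) (x : S) (w : T) :
    \bar R :=
  ereal_inf [set (\sum_(i < n) H i w)%:E | n in
             [set n : nat | (0 < n)%N /\ Y n w = x]].

(* [P x] is the law of the process started in x. *)
Definition irreducible_process (P : S -> probability T R) (Y : nat -> T -> S) :
    Prop :=
  forall x y, (0 < P x [set w | exists n, Y n w = y])%E.

Definition positive_recurrent (P : S -> probability T R)
    (Y : nat -> T -> S) (H : nat -> T -> R) (x : S) : Prop :=
  (\int[P x]_w return_time Y H x w < +oo)%E.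

Definition ergodic (P : S -> probability T R)
    (Y : nat -> T -> S) (H : nat -> T -> R) : Prop :=
  irreducible_process P Y /\ forall x, positive_recurrent P Y H x.

End Paths.

(* Probability distributions solving the global balance equations pi Q = 0. *)
Definition stationary_distribution rate (pi : S -> R) : Prop :=
  [/\ forall x, 0 <= pi x,
      esum setT (fun x => (pi x)%:E) = 1%E
    & forall y, (pi y * exit_rate rate y)%:E =
                esum [set~ y] (fun x => (pi x * rate x y)%:E)].

End MarkovJumpProcess.

Section CoxQueue.
Context {R : realType}.
Variables (k : nat) (lam q : nat -> R) (mu : R) (b : nat) (p : nat -> R).

(* Only lam i and q i for i < k, and p j for 1 <= j <= b, are ever used. *)
Definition cox_batch_params : Prop :=
  [/\ forall i, (i < k)%N -> 0 < lam i,
      forall i, (i.+1 < k)%N -> 0 < q i <= 1,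
      q k.-1 = 0,
      0 < mu
    & (forall j, (1 <= j <= b)%N -> 0 <= p j) /\
      \sum_(1 <= j < b.+1) p j = 1].

(* C is a Coxian time: N is the index of the phase in which C ends and V i the
   length of phase i. *)
Definition coxian {d} {T : measurableType d} (P : probability T R)
    (C : T -> R) : Prop :=
  exists (N : T -> nat) (V : nat -> T -> R),
    [/\ forall n, measurable (N @^-1` [set n]),
        forall i, measurable_fun setT (V i),
        forall i w, 0 <= V i w,
        forall (n : nat) (t : nat -> R), (n < k)%N -> (forall i, 0 <= t i) ->
          P [set w | N w = n /\ forall i, (i <= n)%N -> t i < V i w] =
          ((\prod_(i < n) q i) * (1 - q n)
           * \prod_(i < n.+1) expR (- (lam i * t i)))%:E
      & forall w, C w = \sum_(i < (N w).+1) V i w].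

Definition batch_size {d} {T : measurableType d} (P : probability T R)
    (Y : T -> nat) : Prop :=
  (forall j, measurable (Y @^-1` [set j])) /\
  (forall j, (1 <= j <= b)%N -> P (Y @^-1` [set j]) = (p j)%:E).

Definition phiY (x : R) : R := \sum_(1 <= j < b.+1) p j * x ^+ j.

(* States are (level, phase).  Phase completions, arrivals and services never
   connect the same ordered pair of states. *)
Definition cox_rate (x y : nat * 'I_k) : R :=
  let: (m, i) := x in let: (m', i') := y in
  (if (m' == m) && (i' == i.+1 :> nat) then q i * lam i else 0)
  + (if (m' == m.+1) && (i' == 0%N :> nat) then (1 - q i) * lam i else 0)
  + (if (m' < m)%N && (i' == i) then
       if m' == 0%N then mu * \sum_(1 <= j < b.+1 | (m <= j)%N) p j
       else if (m - m' <= b)%N then mu * p (m - m')%N else 0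
     else 0).

Definition alpha (g : R) (i : nat) : R :=
  lam i.-1 / (lam i + mu - mu * phiY g).

Definition coxF (g : R) : R :=
  (lam 0%N * (1 - q 0%N)
   + \sum_(1 <= i < k)
       (\prod_(1 <= l < i.+1)
          (q l.-1 * (lam l.-1 / (lam l + mu - mu * phiY g))))
       * (1 - q i) * lam i
   + g * mu * phiY g) / (lam 0%N + mu).

Definition mean_interarrival : R :=
  \sum_(0 <= i < k) (lam i)^-1 * \prod_(0 <= l < i) q l.

Definition mean_batch : R := \sum_(1 <= j < b.+1) j%:R * p j.

End CoxQueue.

(* Main.v *)
Require Import Defs.
From HB Require Import structures.
From mathcomp Require Import all_boot all_order all_algebra.
From mathcomp Require Import all_classical all_reals all_analysis.
From mathcomp Require Import measurable_realfun.
From mathcomp Require Import ring lra zify.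
Import Order.TTheory GRing.Theory Num.Theory.
Import numFieldNormedType.Exports.
Local Open Scope classical_set_scope.
Local Open Scope ring_scope.
Set Implicit Arguments.
Unset Strict Implicit.
Unset Printing Implicit Defensive.

(* Let f_n(y) be the probability that the jump chain started in x is in y after
   n jumps without having returned to x. As the exit rates are bounded above and
   below, x is positive recurrent iff sum_n sum_y f_n(y) < oo. In that case
   sum_n f_n is a summable invariant measure of the jump chain; conversely any
   stationary distribution with pi(x) > 0 dominates a multiple of sum_n f_n. So
   ergodicity amounts to the existence of a stationary distribution, which is
   then unique and positive: the minimum of two summable invariant measures is
   invariant, and an invariant measure is zero or everywhere positive.

   A stationary distribution is tested against the function
   min(level, M) - (mean residual inter-arrival time) / E C, whose drift is
   1 / E C - mu E(min(Y, level)) below level M; letting M tend to infinity gives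
   1 / E C < mu E Y, strictly because level 0 has positive mass. If conversely
   this inequality holds, an intermediate value argument for the equation
   g = F(g), divided by its trivial root factor 1 - g, yields g in (0, 1), and
   the product formula solves the balance equations. The root g is unique because
   it is a ratio of two stationary probabilities. *)

(** * Sums of extended reals *)

Section ExtendedSums.
Context {R : realType}.
Local Open Scope ereal_scope.

(** Sums over states are taken in the nonnegative extended reals. They can then be exchanged without
    any summability argument, and finiteness matters only where a term is cancelled. This is why
    balance is kept as an equality of outflow and inflow, and why the drift function is shifted to
    be nonnegative. The return time is not shown to be measurable. It is squeezed between two
    measurable functions that differ only when no return ever occurs, an event that is null as soon
    as the expected number of jumps is finite. Truncating the level in the drift argument is
    essential: a stationary distribution is not known beforehand to have a finite mean level,
    whereas the truncated function is bounded, so that its mean outflow is finite and cancels. The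
    residual time compensates for the arrival rate depending on the phase: with it, arrivals and
    phase changes together contribute 1 / E C from every phase. Reading g off the stationary
    distribution replaces a convexity study of F. *)

Lemma esum_le_term (T : choiceType) (a : T -> \bar R) i :
  (forall j, 0 <= a j) -> a i <= esum setT a.
Proof. by move=> a0; apply: esum_ge; exists [set i] => //; rewrite fsbig_set1. Qed.

Lemma esumZl (T : choiceType) (c : \bar R) (a : T -> \bar R) :
  0 <= c -> (forall i, 0 <= a i) ->
  esum setT (fun i => c * a i) = c * esum setT a.
Proof.
move=> c0 a0; have es0 : 0 <= esum setT a by exact: esum_ge0.
apply/eqP; rewrite eq_le; apply/andP; split.
  apply: ge_ereal_sup => _ [X [finX _] <-].
  rewrite -ge0_mule_fsumr//; apply: lee_wpmul2l => //.
  by apply: esum_ge; exists X.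
(* For [c] infinite, either all terms vanish or one nonzero term already makes the sum infinite. *)
case: c c0 => [c|_|//]; last first.
  have [e0|/eqP e0] := pselect (esum setT a = 0).
    by rewrite e0 mule0 esum_ge0// => i _; rewrite mule_ge0.
  have [i ai] : exists i, a i != 0.
    apply: contrapT => h; apply: (negP e0); apply/eqP/esum1 => i _.
    by apply/eqP/negPn/negP => ?; apply: h; exists i.
  apply: (@le_trans _ _ (+oo * a i)).
    by rewrite [in leRHS]gt0_mulye ?leey// lt0e ai a0.
  by apply: (esum_le_term (a := fun i => +oo * a i)) => j; rewrite mule_ge0.
rewrite lee_fin => c0; move: c0; rewrite [(0 <= c)%R]le_eqVlt => /predU1P[<-|c0].
  by rewrite mul0e esum_ge0// => i _; rewrite mul0e.
rewrite -lee_pdivlMl//; apply: ge_ereal_sup => _ [X [finX _] <-].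
rewrite lee_pdivlMl// ge0_mule_fsumr//.
by apply: esum_ge; exists X.
Qed.

Lemma esumZr (T : choiceType) (c : \bar R) (a : T -> \bar R) :
  0 <= c -> (forall i, 0 <= a i) ->
  esum setT (fun i => a i * c) = esum setT a * c.
Proof. by move=> c0 a0; under eq_esum do rewrite muleC; rewrite esumZl// muleC. Qed.

Lemma esum_exchange (T T' : choiceType) (a : T -> T' -> \bar R) :
  (forall i j, 0 <= a i j) ->
  esum setT (fun i => esum setT (a i)) = esum setT (fun j => esum setT (a^~ j)).
Proof.
move=> a0; rewrite (esum_esum (I := setT) (J := fun=> setT))//.
rewrite (esum_esum (I := setT) (J := fun=> setT) (a := fun j i => a i j))//.
rewrite (reindex_esum (setT `*`` fun=> setT) (setT `*`` fun=> setT)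
  (fun x : T' * T => (x.2, x.1)))//.
split => //; first by move=> [x1 x2] [y1 y2] _ _ /= [-> ->].
by move=> [x1 x2] _; exists (x2, x1).
Qed.

Lemma esum_delta (T : choiceType) (x : T) (a : T -> \bar R) :
  0 <= a x -> (forall y, y != x -> a y = 0) -> esum setT a = a x.
Proof.
move=> a0 a1; have aT y : 0 <= a y by have [->//|/a1->] := eqVneq y x.
rewrite (esumID [set x])// setTI esum_set1// setTI esum1 ?adde0//.
by move=> y /= /eqP/a1.
Qed.

Lemma esum_ltyP (T : choiceType) (a : T -> \bar R) :
  (forall i, 0 <= a i) -> esum setT a < +oo -> forall i, a i < +oo.
Proof. by move=> a0 h i; apply: le_lt_trans h; exact: esum_le_term. Qed.

(** A strict inequality at one index would leave a gap between the two totals, which are finite.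
    This turns inequalities between measures of equal mass into equalities. *)
Lemma eq_of_esum (T : choiceType) (a b : T -> \bar R) :
  (forall i, 0 <= a i) -> (forall i, a i <= b i) ->
  esum setT b < +oo -> esum setT b <= esum setT a -> forall i, a i = b i.
Proof.
move=> a0 ab boo ba i; apply/eqP; rewrite eq_le ab/= leNgt; apply/negP => abi.
have b0 j : 0 <= b j by exact: le_trans (ab j).
have aoo : esum setT a < +oo by apply: le_lt_trans boo; apply: le_esum => j _.
have ai : a i \is a fin_num by rewrite ge0_fin_numE//; exact: esum_ltyP.
pose c j := if j == i then b i - a i else 0.
have c0 j : 0 <= c j.
  by rewrite /c; case: ifP => // _; rewrite leeBrDr// add0e ltW.
have : esum setT a + (b i - a i) <= esum setT b.
  rewrite -[X in _ + X <= _](_ : esum setT c = _); last first.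
    by rewrite (@esum_delta _ i) /c ?eqxx// ?leeBrDr ?add0e ?ltW// => y /negbTE->.
  rewrite -(@esumD _ _ setT a c)//; apply: le_esum => j _; rewrite /c.
  by case: eqP => [->|_]; rewrite ?adde0// addeC subeK.
apply/negP; rewrite -ltNge; apply: (le_lt_trans ba).
have af : esum setT a \is a fin_num by rewrite ge0_fin_numE// esum_ge0.
by rewrite lteDl// sube_gt0.
Qed.

Lemma esum_fin_support (T : choiceType) (s : seq T) (a : T -> \bar R) :
  uniq s -> (forall i, 0 <= a i) -> (forall i, i \notin s -> a i = 0) ->
  esum setT a = \sum_(i <- s) a i.
Proof.
move=> us a0 as0; rewrite (esumID [set` s])// setTI (esum_fset (finite_seq s))//.
rewrite [X in _ + X]esum1 ?adde0; first by rewrite -fsbig_seq.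
by move=> i [_ /= /negP]; exact: as0.
Qed.

(** Enumerates the type by its codes, padding with zeros, so that countable additivity and monotone
    convergence for series apply to sums over states. *)
Lemma esum_pickle (S : countType) (a : S -> \bar R) : (forall u, 0 <= a u) ->
  esum setT a = \sum_(n <oo) oapp a 0 (pickle_inv n).
Proof.
move=> a0; rewrite nneseries_esumT; last by move=> n; case: pickle_inv => //=.
rewrite (esumID (range (@pickle S))) ?setTI; last first.
  by move=> n _; case: pickle_inv => //=.
rewrite [X in _ + X]esum1 ?adde0; last first.
  move=> n /= hn; case E : (pickle_inv n) => [u|]//.
  exfalso; apply: hn; exists u => //.
  by have := @pickle_invK S n; rewrite /ocancel/= E.
rewrite esum_image; last by move=> x y _ _ /(pcan_inj pickleK).
by apply: eq_esum => u _ /=; rewrite pickleK_inv.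
Qed.

Lemma measure_bigcup_countable d (T : measurableType d) (S : countType)
    (mu : {measure set T -> \bar R}) (A : S -> set T) :
  (forall u, measurable (A u)) -> trivIset setT A ->
  mu (\bigcup_u A u) = esum setT (mu \o A).
Proof.
move=> mA tA; pose B n := if pickle_inv n is Some u then A u else set0.
have BA u : B (pickle u) = A u by rewrite /B pickleK_inv.
have -> : \bigcup_u A u = \bigcup_n B n.
  apply/seteqP; split => w [i _ wi]; first by exists (pickle i) => //; rewrite BA.
  by move: wi; rewrite /B; case: pickle_inv => // u wu; exists u.
rewrite measure_bigcup//; last 2 first.
- by move=> n _; rewrite /B; case: pickle_inv.
- apply/trivIsetP => i j _ _ ij; rewrite /B.
  case Ei : (pickle_inv i) => [u|]; last by rewrite set0I.
  case Ej : (pickle_inv j) => [v|]; last by rewrite setI0.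
  move/trivIsetP : tA => -> //; apply: contraNneq ij => uv; apply/eqP.
  have := @pickle_invK S i; have := @pickle_invK S j.
  by rewrite /ocancel/= Ei Ej /= uv => -> ->.
rewrite esum_pickle// (eq_eseriesl (Q := xpredT)); last first.
  by move=> n; rewrite in_setT.
by apply: eq_eseriesr => n _; rewrite /B; case: pickle_inv => //=.
Qed.

Lemma measurable_esum d (T : measurableType d) (S : countType)
    (f : S -> T -> \bar R) :
  (forall u, measurable_fun setT (f u)) -> (forall u w, 0 <= f u w) ->
  measurable_fun setT (fun w => esum setT (f^~ w)).
Proof.
move=> mf f0; apply: (eq_measurable_fun
  (fun w => \sum_(0 <= n <oo | n \in xpredT) oapp (f^~ w) 0 (pickle_inv n))).
  by move=> w _; rewrite esum_pickle.
apply: ge0_emeasurable_sum => [n w _ _|n _]; first by case: pickle_inv => //=.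
by case: pickle_inv => [u|] /=; [exact: mf|exact: measurable_cst].
Qed.

Lemma integral_esum d (T : measurableType d) (S : countType)
    (mu : {measure set T -> \bar R}) (f : S -> T -> \bar R) :
  (forall u, measurable_fun setT (f u)) -> (forall u w, 0 <= f u w) ->
  \int[mu]_w esum setT (f^~ w) = esum setT (fun u => \int[mu]_w f u w).
Proof.
move=> mf f0; rewrite esum_pickle; last by move=> u; exact: integral_ge0.
under eq_integral do rewrite esum_pickle//.
rewrite integral_nneseries//; last 2 first.
- by move=> n; case: pickle_inv => [u|] /=; [exact: mf|exact: measurable_cst].
- by move=> n w _; case: pickle_inv => //=.
apply: eq_eseriesr => n _; case: pickle_inv => //=.
by rewrite integral0.
Qed.

Lemma esum_nat_lim_le (a : nat -> \bar R) (c : \bar R) :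
  (forall n, 0 <= a n) -> (forall N, \sum_(n < N) a n <= c) -> esum setT a <= c.
Proof.
move=> a0 ac; rewrite -nneseries_esumT//; apply: lime_le.
  by apply: is_cvg_nneseries.
by near=> n; rewrite big_mkord.
Unshelve. all: by end_near. Qed.

Lemma esum_nat_ge (a : nat -> \bar R) N :
  (forall n, 0 <= a n) -> \sum_(n < N) a n <= esum setT a.
Proof.
by move=> a0; rewrite -nneseries_esumT// -(big_mkord xpredT a); exact: nneseries_lim_ge.
Qed.

Lemma esum_nat_recl (a : nat -> \bar R) :
  (forall n, 0 <= a n) -> esum setT a = a 0%N + esum setT (fun n => a n.+1).
Proof.
move=> a0; rewrite (esumID [set 0%N])// !setTI esum_set1//; congr (_ + _).
rewrite (_ : ~` [set 0%N] = range S); first by rewrite esum_image// => x y _ _ [].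
by apply/seteqP; split => [[|n] n0|n [m _ <-]//]; [exfalso; exact: n0|exists n].
Qed.

(** The integral of a nonnegative function is a supremum over simple functions below it, hence
    monotone even without measurability; needed for [return_time]. *)
Lemma ge0_le_integral_nomeas d (T : measurableType d)
    (mu : {measure set T -> \bar R}) (f g : T -> \bar R) :
  (forall x, 0 <= f x) -> (forall x, f x <= g x) ->
  \int[mu]_x f x <= \int[mu]_x g x.
Proof.
move=> f0 fg; rewrite !ge0_integralTE//; last by move=> x; exact: le_trans (fg x).
apply: le_ereal_sup => _ [h hf <-]; exists h => // x.
exact: le_trans (hf x) (fg x).
Qed.

(* By the layer cake formula. *)
Lemma integral_exponential_on d (T : measurableType d) (P : probability T R)
    (A : set T) (H : T -> R) (c l : R) :
  measurable A -> measurable_fun setT H -> (forall w, (0 <= H w)%R) ->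
  (0 <= c)%R -> (0 < l)%R ->
  (forall t : R, (0 <= t)%R ->
     P (A `&` [set w | (t < H w)%R]) = (c * expR (- (l * t)))%:E) ->
  \int[P]_w (H w * \1_A w)%:E = (c / l)%:E.
Proof.
move=> mA mH H0 c0 l0 tail.
have mX : measurable_fun setT (fun w => H w * \1_A w)%R.
  by apply: measurable_funM => //; exact: measurable_indic.
pose X : {RV P >-> R} := HB.pack (fun w => H w * \1_A w)%R
  (@isMeasurableFun.Build _ _ _ _ (fun w => H w * \1_A w)%R mX).
have X0 w : (0 <= X w)%R by rewrite mulr_ge0.
transitivity ('E_P[X]); first by rewrite unlock.
rewrite ge0_expectation_ccdf//.
(* The tail at [r] is [c / l] times the exponential density, whose integral is 1. *)
transitivity (\int[lebesgue_measure]_(r in `[0%R, +oo[)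
    ((c / l)%:E * (exponential_pdf l r)%:E)).
  apply: eq_integral => r; rewrite inE/= in_itv/= andbT => r0.
  rewrite exponential_pdfE// /ccdf /distribution/= /pushforward/=.
  rewrite -EFinM mulrA divfK ?gt_eqF// mulNr -tail//; congr (P _).
  apply/seteqP; split => w /=; rewrite in_itv/= andbT indicE.
    case: (boolP (w \in A)); last by rewrite mulr0 ltNge r0.
    by rewrite inE mulr1 => wA rH; split.
  by move=> [wA rH]; rewrite mem_set// mulr1.
rewrite ge0_integralZl//; last 3 first.
- by apply/measurable_EFinP; apply: measurable_funTS; exact: measurable_exponential_pdf.
- by move=> x _; rewrite lee_fin exponential_pdf_ge0// ltW.
- by rewrite lee_fin divr_ge0// ltW.
suff -> : \int[lebesgue_measure]_(r in `[0%R, +oo[) (exponential_pdf l r)%:E = 1.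
  by rewrite mule1.
rewrite -(integral_exponential_pdf l0) integral_mkcond.
apply: eq_integral => x _; rewrite patchE; case: ifPn => // xn.
by rewrite /exponential_pdf patchE (negbTE xn).
Qed.

End ExtendedSums.
(** * Return times of jump processes *)

Section TabooProbabilities.
Context {R : realType} {S : countType}.
Variables (rate : S -> S -> R) (x0 : S).
Local Open Scope ereal_scope.

(* The probability of being in [y] after [n] jumps from [x0] without a
   return to [x0] in between or at the end. *)
Fixpoint taboo (n : nat) (y : S) : \bar R :=
  if n is n'.+1 then
    if y == x0 then 0
    else esum setT (fun z => taboo n' z * (jump_prob rate z y)%:E)
  else (y == x0)%:R%:E.

Hypothesis jump_ge0 : forall x y, (0 <= jump_prob rate x y)%R.

Lemma taboo_ge0 n y : 0 <= taboo n y.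
Proof.
elim: n y => [|n IH] y /=; first by rewrite lee_fin.
by case: ifP => // _; apply: esum_ge0 => z _; rewrite mule_ge0// lee_fin.
Qed.

End TabooProbabilities.

Section ReturnTime.
Context {R : realType} {S : countType} {d : measure_display} {T : measurableType d}.
Variables (rate : S -> S -> R) (P : probability T R).
Variables (X : nat -> T -> S) (H : nat -> T -> R) (x0 : S).
Hypothesis jump_ge0 : forall x y, (0 <= jump_prob rate x y)%R.
Hypothesis exit_gt0 : forall x, (0 < exit_rate rate x)%R.
Hypothesis hX : markov_jump_process rate P X H x0.
Local Open Scope ereal_scope.

Let mX n x : measurable (X n @^-1` [set x]). Proof. by case: hX. Qed.
Let mH n : measurable_fun setT (H n). Proof. by case: hX. Qed.
Let H0 n w : (0 < H n w)%R. Proof. by case: hX. Qed.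
Let E := exit_rate rate.
Let f := taboo rate x0.
Let f0 n y : 0 <= f n y. Proof. exact: taboo_ge0. Qed.

Definition no_return n : set T := [set w | forall i, (0 < i <= n)%N -> X i w <> x0].

Definition taboo_path n m (z : nat -> S) (t : R) : set T :=
  [set w | no_return n w /\ (forall i, (i <= m)%N -> X (n + i) w = z i) /\
           (t < H (n + m) w)%R].

Lemma measurable_no_return n : measurable (no_return n).
Proof.
rewrite (_ : no_return n =
  \bigcap_i (if (0 < i <= n)%N then ~` (X i @^-1` [set x0]) else setT)).
  by apply: bigcapT_measurable => i; case: ifP => // _; exact: measurableC.
apply/seteqP; split => w h i; first by move=> _; case: ifP => // /h.
by move=> i0; have := h i Logic.I; rewrite i0.
Qed.

Let mHt n t : measurable [set w | (t < H n w)%R].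
Proof.
rewrite -[X in measurable X]setTI -preimage_true.
by apply: measurable_fun_ltr.
Qed.

Lemma measurable_taboo_path n m z t : measurable (taboo_path n m z t).
Proof.
rewrite (_ : taboo_path n m z t = no_return n `&`
  (\bigcap_i (if (i <= m)%N then X (n + i) @^-1` [set z i] else setT) `&`
   [set w | (t < H (n + m) w)%R])).
  apply: measurableI; first exact: measurable_no_return.
  by apply: measurableI => //; apply: bigcapT_measurable => i; case: ifP.
apply/seteqP; split => w [nr [h1 h2]]; split => //; split => // i.
  by move=> _; case: ifP => // /h1.
by move=> im; have := h1 i Logic.I; rewrite im.
Qed.

(** Induction on [n] with the prescribed path [z] general: splitting over the state [u] at time [n]
    trades one taboo step for one more prescribed state in front of [z]. At [n = 0] this is the law
    of the process with threshold 0 for every holding time but the last. *)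
Lemma probability_taboo_path n m z t : (0 <= t)%R ->
  P (taboo_path n m z t) = f n (z 0%N) *
    (\prod_(i < m) jump_prob rate (z i) (z i.+1) * expR (- (E (z m) * t)))%:E.
Proof.
move=> t0; elim: n m z => [|n IH] m z.
  have [_ _ _ /(_ m z (fun i => if i == m then t else 0%R))] := hX.
  have -> : [set w | forall i, (i <= m)%N -> X i w = z i /\
      ((if i == m then t else 0) < H i w)%R] = taboo_path 0 m z t.
    apply/seteqP; split => w h.
      split; first by move=> i; rewrite leqn0 lt0n; case: eqP.
      split=> [i /h[]//|]; rewrite add0n.
      by have [_] := h m (leqnn m); rewrite eqxx.
    move: h => [_ [h1 h2]] i im; split; first exact: h1.
    by case: eqP => // ->.
  move=> ->; last by move=> i; case: ifP.
  rewrite /f/= -EFinM -mulrA; congr (_ * (_ * _))%:E.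
  rewrite big_ord_recr/= eqxx big1 ?mul1r// => i _.
  by rewrite (ltn_eqF (ltn_ord i)) mulr0 oppr0 expR0.
rewrite /f/=; case: ifPn => [/eqP z0|z0].
  rewrite mul0e (_ : taboo_path _ _ _ _ = set0) ?measure0//.
  rewrite -subset0 => w [nr [/(_ 0%N isT)]]; rewrite addn0 z0 => Xx0.
  by exfalso; apply: (nr n.+1) => //; rewrite ltnS leqnn.
pose ext u i := if i is j.+1 then z j else u.
have -> : taboo_path n.+1 m z t = \bigcup_u taboo_path n m.+1 (ext u) t.
  apply/seteqP; split => w.
    move=> [nr [h1 h2]]; exists (X n w) => //; split=> [i /andP[i0 ni]|].
      by apply: nr; rewrite i0 ltnW.
    split; last by rewrite addnS -addSn.
    by case=> [|i] im /=; [rewrite addn0|rewrite addnS -addSn h1].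
  move=> [u _ [nr [h1 h2]]]; split; last first.
    split; last by rewrite addSn -addnS.
    by move=> i im; rewrite addSn -addnS (h1 i.+1).
  move=> i /andP[i0]; rewrite leq_eqVlt => /orP[/eqP ->|].
    by have := h1 1%N isT; rewrite addn1/= => ->; exact/eqP.
  by rewrite ltnS => ni; apply: nr; rewrite i0.
rewrite measure_bigcup_countable; last 2 first.
- by move=> u; exact: measurable_taboo_path.
- apply/trivIsetP => u v _ _ uv; rewrite -subset0 => w [[_ [h1 _]] [_ [h2 _]]].
  move: (h1 0%N isT) (h2 0%N isT) => /= -> uv'.
  by move: uv; rewrite uv' eqxx.
rewrite -esumZr; last 2 first.
- by rewrite lee_fin mulr_ge0 ?expR_ge0// prodr_ge0.
- by move=> u; rewrite mule_ge0// ?lee_fin// f0.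
apply: eq_esum => u _ /=; rewrite IH/= big_ord_recl/= -mulrA EFinM muleA.
by congr (_ * _); congr (_ * _)%:E; congr (_ * _)%R; apply: eq_bigr.
Qed.

Let B n y : set T := no_return n `&` X n @^-1` [set y].
Let mB n y : measurable (B n y).
Proof. by apply: measurableI => //; exact: measurable_no_return. Qed.

Lemma probability_taboo_tail n y t : (0 <= t)%R ->
  P (B n y `&` [set w | (t < H n w)%R]) = f n y * (expR (- (E y * t)))%:E.
Proof.
move=> t0; have := @probability_taboo_path n 0 (fun=> y) t t0.
rewrite big_ord0 mul1r => <-; congr (P _); apply/seteqP; split => w.
  move=> [[nr Xy] ?]; split=> //; split; last by rewrite addn0.
  by move=> i; rewrite leqn0 => /eqP->; rewrite addn0.
move=> [nr [h1]]; rewrite addn0 => h2; split => //; split => //.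
by have := h1 0%N isT; rewrite addn0.
Qed.

Lemma probability_taboo n y : P (B n y) = f n y.
Proof.
have := @probability_taboo_tail n y 0%R (lexx _).
rewrite mulr0 oppr0 expR0 mule1 => <-; congr (P _); apply/seteqP.
by split=> w; [move=> ?; split => //=|case].
Qed.

Lemma taboo_fin_num n y : f n y \is a fin_num.
Proof. by rewrite -probability_taboo; exact: fin_num_measure. Qed.

Let no_returnE n : no_return n = \bigcup_y B n y.
Proof.
by apply/seteqP; split => [w nr|w [y _ []]//]; exists (X n w).
Qed.

Lemma probability_no_return n : P (no_return n) = esum setT (f n).
Proof.
rewrite no_returnE measure_bigcup_countable//.
  by apply: eq_esum => y _; exact: probability_taboo.
apply/trivIsetP => u v _ _ uv; rewrite -subset0 => w [[_ h1] [_ h2]].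
by move: uv; rewrite -h1 -h2 eqxx.
Qed.

Lemma integral_holding n :
  \int[P]_w (H n w * \1_(no_return n) w)%:E =
  esum setT (fun y => f n y * (E y)^-1%:E).
Proof.
have fE y : f n y = (fine (f n y))%:E by rewrite fineK// taboo_fin_num.
transitivity (esum setT (fun y => \int[P]_w (H n w * \1_(B n y) w)%:E)).
  rewrite -integral_esum; last 2 first.
  - by move=> y; apply/measurable_EFinP; apply: measurable_realfun.measurable_funM.
  - by move=> y w; rewrite lee_fin mulr_ge0// ltW.
  apply: eq_integral => w _; rewrite (@esum_delta _ _ (X n w)); last 2 first.
  - by rewrite lee_fin mulr_ge0// ltW.
  - by move=> y yX; rewrite indicE memNset ?mulr0// => -[_ /= Xy]; rewrite Xy eqxx in yX.
  congr (_ * _)%:E; rewrite !indicE; congr ((nat_of_bool _)%:R).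
  by apply/idP/idP; rewrite !inE; [move=> nr; split|move=> []].
apply: eq_esum => y _; rewrite fE -EFinM.
apply: integral_exponential_on => //.
- by move=> w; exact: ltW.
- by rewrite fine_ge0.
- by move=> t t0; rewrite probability_taboo_tail// [in LHS]fE.
Qed.

(** The holding times counted as long as no return has occurred. If a return occurs this is the
    return time; otherwise it is the total of all holding times, which could be finite although the
    return time is infinite. *)
Let Z w : \bar R := esum setT (fun n => (H n w * \1_(no_return n) w)%:E).

Let Z0 w : 0 <= Z w.
Proof. by apply: esum_ge0 => n _; rewrite lee_fin mulr_ge0// ltW. Qed.

Let mHU n : measurable_fun setT (fun w => (H n w * \1_(no_return n) w)%:E).
Proof.
apply/measurable_EFinP; apply: measurable_realfun.measurable_funM => //.
by apply: measurable_indic; exact: measurable_no_return.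
Qed.

Let mZ : measurable_fun setT Z.
Proof. by apply: measurable_esum => // n w; rewrite lee_fin mulr_ge0// ltW. Qed.

Let integral_Z : \int[P]_w Z w =
  esum setT (fun n => esum setT (fun y => f n y * (E y)^-1%:E)).
Proof.
rewrite integral_esum//; last by move=> n w; rewrite lee_fin mulr_ge0// ltW.
by apply: eq_esum => n _; exact: integral_holding.
Qed.

Let no_return_le n m w : (n <= m)%N -> no_return m w -> no_return n w.
Proof.
by move=> nm h i /andP[i0 ni]; apply: h; rewrite i0 (leq_trans ni).
Qed.

Let Z_le_return w : Z w <= return_time X H x0 w.
Proof.
apply: le_ereal_inf_tmp => _ [n [n0 Xn] <-].
apply: esum_nat_lim_le => [m|N]; first by rewrite lee_fin mulr_ge0// ltW.
rewrite sumEFin lee_fin.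
apply: (@le_trans _ _ (\sum_(i < N | (i < n)%N) H i w)%R).
  rewrite [leRHS]big_mkcond/=; apply: ler_sum => i _; case: ifPn => [_|].
    by rewrite ler_piMr// ?(ltW (H0 _ _))// indicE lern1 leq_b1.
  rewrite -leqNgt => ni; rewrite indicE memNset ?mulr0//= => /(no_return_le ni).
  by move/(_ n); rewrite n0 leqnn => /(_ isT); exact.
rewrite -!(big_mkord (fun i => (i < n)%N) (fun i => H i w)).
rewrite -(big_mkord xpredT (fun i => H i w)).
rewrite (big_nat_widen 0 N (n + N)) ?leq_addl//.
rewrite (big_nat_widen 0 n (n + N)) ?leq_addr//.
rewrite big_mkcond [leRHS]big_mkcond; apply: ler_sum => i _ /=.
by case: (i < n)%N; case: (i < N)%N => //=; exact: ltW.
Qed.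

Let never : set T := \bigcap_n no_return n.

Let return_le_Z w : return_time X H x0 w <= Z w + +oo * (\1_never w)%:E.
Proof.
have [nw|] := pselect (never w).
  by rewrite indicE mem_set// mule1 addey ?leey// gt_eqF// (lt_le_trans _ (Z0 w)).
move=> nw; rewrite indicE memNset// mule0 adde0.
have [n0 h0] : exists n, (0 < n)%N && (X n w == x0).
  apply: contrapT => h; apply: nw => n _ i /andP[i0 _] Xi; apply: h.
  by exists i; rewrite i0 Xi eqxx.
have ex : exists n, (0 < n)%N && (X n w == x0) by exists n0.
case: (ex_minnP ex) => n /andP[n_gt0 /eqP Xn] nmin.
apply: (@le_trans _ _ (\sum_(i < n) H i w)%:E).
  by apply: ereal_inf_lbound; exists n.
apply: le_trans (esum_nat_ge n _); last first.
  by move=> m; rewrite lee_fin mulr_ge0// ltW.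
rewrite sumEFin lee_fin; apply: ler_sum => i _.
rewrite indicE mem_set ?mulr1//= => j /andP[j0 ji] Xj.
by have := nmin j; rewrite j0 Xj eqxx leqNgt (leq_ltn_trans ji)// => /(_ isT).
Qed.

Let W := esum setT (fun n => esum setT (f n)).

(** [never] lies in each [no_return n], and the probabilities of these events add up to [W]; so
    every multiple of its probability is at most [W]. *)
Let never_null : W < +oo -> P never = 0.
Proof.
move=> Woo; apply/eqP; rewrite eq_le measure_ge0 andbT leNgt; apply/negP => c0.
have mN : measurable never by apply: bigcapT_measurable => n; exact: measurable_no_return.
have cfin : P never \is a fin_num by exact: fin_num_measure.
have W0 : 0 <= W by apply: esum_ge0 => n _; exact: esum_ge0.
have Wfin : W \is a fin_num by rewrite ge0_fin_numE.
have le N : (N%:R * fine (P never) <= fine W)%R.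
  rewrite -lee_fin EFinM !fineK//.
  apply: le_trans (esum_nat_ge N _); last by move=> n; exact: esum_ge0.
  apply: (@le_trans _ _ (\sum_(n < N) P never)).
    by rewrite -(fineK cfin) sumEFin sumr_const card_ord -EFinM mulr_natl.
  apply: lee_sum => n _; rewrite -probability_no_return.
  by apply: le_measure; rewrite ?inE//; [exact: measurable_no_return|move=> w; exact].
have c1 : (0 < fine (P never))%R by rewrite -lte_fin fineK.
have := le (Num.truncn (fine W / fine (P never))).+1.
rewrite -ler_pdivlMr// leNgt => /negP; apply.
by rewrite truncnS_gt.
Qed.

Variables (e1 e2 : R).
Hypothesis e1_gt0 : (0 < e1)%R.
Hypothesis exit_bounds : forall x, (e1 <= exit_rate rate x <= e2)%R.

(* The right-hand side [W] is the expected number of jumps before the return: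
   exit rates are bounded away from 0 and infinity, so each jump takes a
   comparable time on average. *)
Lemma integral_return_time_lty :
  \int[P]_w return_time X H x0 w < +oo <-> W < +oo.
Proof.
have e2_gt0 : (0 < e2)%R.
  by have /andP[h1 h2] := exit_bounds x0; rewrite (lt_le_trans e1_gt0)// (le_trans h1).
have fE1 n y : 0 <= f n y * (E y)^-1%:E.
  by rewrite mule_ge0 ?f0// lee_fin invr_ge0 ltW// exit_gt0.
have rt0 w : 0 <= return_time X H x0 w by apply: le_trans (Z_le_return w).
split => h.
  apply: (@le_lt_trans _ _ (e2%:E * \int[P]_w Z w)).
    rewrite integral_Z -esumZl; last 2 first.
    - by rewrite lee_fin ltW.
    - by move=> n; exact: esum_ge0.
    apply: le_esum => n _; rewrite -esumZl// ?lee_fin ?(ltW e2_gt0)//.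
    apply: le_esum => y _; rewrite muleCA -EFinM -[leLHS]mule1.
    apply: lee_wpmul2l; first exact: f0.
    by rewrite lee_fin ler_pdivlMr ?exit_gt0// mul1r; case/andP: (exit_bounds y).
  apply: lte_mul_pinfty; rewrite ?lee_fin ?(ltW e2_gt0)//.
  by apply: le_lt_trans h; apply: ge0_le_integral_nomeas.
(* The infinite summand lives on a null event, so only [Z] contributes. *)
apply: (@le_lt_trans _ _ (\int[P]_w (Z w + +oo * (\1_never w)%:E))).
  exact: ge0_le_integral_nomeas.
have mN : measurable never by apply: bigcapT_measurable => n; exact: measurable_no_return.
rewrite ge0_integralD//; last first.
  by apply: measurable_funeM; apply/measurable_EFinP; exact: measurable_indic.
rewrite ge0_integralZl//; last by apply/measurable_EFinP; exact: measurable_indic.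
rewrite integral_indic// setIT; move: (never_null h) => /= ->.
rewrite mule0 adde0 integral_Z.
apply: (@le_lt_trans _ _ (e1^-1%:E * W)); last first.
  by apply: lte_mul_pinfty => //; rewrite lee_fin invr_ge0 ltW.
rewrite -esumZl; last 2 first.
- by rewrite lee_fin invr_ge0 ltW.
- by move=> n; exact: esum_ge0.
apply: le_esum => n _; rewrite -esumZl//; last by rewrite lee_fin invr_ge0 ltW.
apply: le_esum => y _; rewrite muleC; apply: lee_wpmul2r; first exact: f0.
by rewrite lee_fin lef_pV2 ?posrE ?exit_gt0//; case/andP: (exit_bounds y).
Qed.

End ReturnTime.
(** * Invariant measures and stationary distributions *)

Section InvariantMeasures.
Context {R : realType} {S : countType}.
Variable rate : S -> S -> R.
Hypothesis rate_ge0 : forall x y, 0 <= rate x y.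
(** [exit_rate] goes through [fine], which sends an infinite sum to 0; this equation excludes that
    case. *)
Hypothesis exit_sum : forall x,
  (exit_rate rate x)%:E = esum [set~ x] (fun y => (rate x y)%:E).
Variables e1 e2 : R.
Hypothesis e1_gt0 : 0 < e1.
Hypothesis exit_bounds : forall x, e1 <= exit_rate rate x <= e2.

Notation E := (exit_rate rate).
Notation Pj := (jump_prob rate).

Lemma exit_rate_gt0 x : 0 < E x.
Proof. by apply: lt_le_trans e1_gt0 _; case/andP: (exit_bounds x). Qed.
Let E0 := exit_rate_gt0.

Let e2_gt0 (x : S) : 0 < e2.
Proof. by apply: lt_le_trans (E0 x) _; case/andP: (exit_bounds x). Qed.

Lemma jump_prob_ge0 x y : 0 <= Pj x y.
Proof. by rewrite /jump_prob; case: ifP => // _; rewrite divr_ge0// ltW. Qed.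
Let P0 := jump_prob_ge0.

Lemma esum_setC1 (x : S) (a : S -> \bar R) :
  esum [set~ x] a = esum setT (fun y => if y == x then 0%E else a y).
Proof.
rewrite esum_mkcond; apply: eq_esum => y _.
rewrite (_ : y \in [set~ x] = (y != x)) ?if_neg//.
by apply/idP/idP => [/set_mem/= /eqP//|/eqP yx]; exact/mem_set.
Qed.

Lemma jump_prob_sum x : esum setT (fun y => (Pj x y)%:E) = 1%E.
Proof.
transitivity ((E x)^-1%:E * (E x)%:E)%E; last by rewrite -EFinM mulVf// gt_eqF.
rewrite exit_sum esum_setC1 -esumZl; last 2 first.
- by rewrite lee_fin invr_ge0 ltW.
- by move=> y; case: ifP => // _; rewrite lee_fin.
apply: eq_esum => y _; rewrite /jump_prob; case: ifP => _; first by rewrite mule0.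
by rewrite -EFinM mulrC.
Qed.

Lemma esum_rate_jump (pi : S -> R) y :
  esum [set~ y] (fun x => (pi x * rate x y)%:E) =
  esum setT (fun x => (pi x * E x * Pj x y)%:E).
Proof.
rewrite esum_setC1; apply: eq_esum => x _; rewrite /jump_prob eq_sym.
case: ifP => _; first by rewrite mulr0.
by congr (_%:E); rewrite -mulrA [E x * _]mulrC divfK// gt_eqF.
Qed.

(** Invariance under the jump chain; a distribution stationary for the process corresponds to
    [nu x = pi x * E x]. *)
Definition invariant (nu : S -> R) : Prop :=
  (forall x, 0 <= nu x) /\
  forall y, (nu y)%:E = esum setT (fun x => (nu x * Pj x y)%:E).

Definition rate_connected : Prop := forall x y, exists2 s : seq S,
  path (fun x y => (y != x) && (0 < rate x y)) x s & last x s = y.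

Lemma stationary_invariant pi : stationary_distribution rate pi ->
  invariant (fun x => pi x * E x).
Proof.
move=> [pi0 _ pib]; split=> [x|y]; first by rewrite mulr_ge0// ltW.
by rewrite pib esum_rate_jump.
Qed.

(** Unrolling invariance once moves the bound from [N] to [N + 1]. At [x0] itself only the term
    [n = 0] survives. *)
Lemma taboo_le_invariant nu x0 : invariant nu -> forall N y,
  ((nu x0)%:E * \sum_(n < N) taboo rate x0 n y <= (nu y)%:E)%E.
Proof.
move=> [nu0 nuP]; elim=> [|N IH] y; first by rewrite big_ord0 mule0 lee_fin.
rewrite big_ord_recl/=; have [->|yx0] := eqVneq y x0.
  by rewrite big1// adde0 mule1.
rewrite add0e -esum_sum; last by move=> z n _ _; rewrite mule_ge0// ?taboo_ge0// lee_fin.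
rewrite -esumZl; last 2 first.
- by rewrite lee_fin.
- by move=> z; apply: sume_ge0 => n _; rewrite mule_ge0// ?taboo_ge0// lee_fin.
rewrite (nuP y); apply: le_esum => z _.
rewrite -ge0_sume_distrl; last by move=> n _; exact: taboo_ge0.
by rewrite muleA EFinM; apply: lee_wpmul2r; rewrite ?lee_fin.
Qed.

Lemma stationary_taboo pi x0 : stationary_distribution rate pi -> 0 < pi x0 ->
  (esum setT (fun n => esum setT (taboo rate x0 n)) < +oo)%E.
Proof.
move=> pis pix; have [pi0 pi1 _] := pis; have inv := stationary_invariant pis.
have nu0 : 0 < pi x0 * E x0 by rewrite mulr_gt0.
rewrite esum_exchange; last by move=> *; exact: taboo_ge0.
have le y : (esum setT (fun n => taboo rate x0 n y) <=
             (pi x0 * E x0)^-1%:E * (pi y * E y)%:E)%E.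
  apply: esum_nat_lim_le => [n|N]; first exact: taboo_ge0.
  by rewrite lee_pdivlMl// (taboo_le_invariant x0 inv).
apply: (@le_lt_trans _ _
  (esum setT (fun y => ((pi x0 * E x0)^-1 * e2)%:E * (pi y)%:E)%E)).
  apply: le_esum => y _; apply: le_trans (le y) _.
  rewrite -!EFinM lee_fin -mulrA ler_pM2l ?invr_gt0// mulrC.
  by rewrite ler_wpM2r//; case/andP: (exit_bounds y).
rewrite esumZl ?pi1 ?mule1 ?ltry// lee_fin.
by rewrite mulr_ge0 ?invr_ge0 ?(ltW nu0) ?(ltW (e2_gt0 x0)).
Qed.

(** * Occupation measure of a cycle *)

Section Occupation.
Variable x0 : S.
Let f := taboo rate x0.
Let f0 n y : (0 <= f n y)%E. Proof. exact: taboo_ge0. Qed.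
Let G y := esum setT (f^~ y).
Let G0 y : (0 <= G y)%E. Proof. exact: esum_ge0. Qed.
Hypothesis Woo : (esum setT (fun n => esum setT (f n)) < +oo)%E.

Let GW : (esum setT G < +oo)%E.
Proof. by rewrite /G -esum_exchange. Qed.

Let Gx0 : G x0 = 1%E.
Proof.
rewrite /G esum_nat_recl// /f/= eqxx [X in (_ + X)%E]esum1 ?adde0//.
Qed.

Let h y := esum setT (fun z => G z * (Pj z y)%:E)%E.
Let h0 y : (0 <= h y)%E.
Proof. by apply: esum_ge0 => z _; rewrite mule_ge0// lee_fin. Qed.

Let hE y : h y = esum setT (fun n => esum setT (fun z => f n z * (Pj z y)%:E)%E).
Proof.
rewrite esum_exchange; last by move=> n z; rewrite mule_ge0// ?f0// lee_fin.
by apply: eq_esum => z _; rewrite esumZr// ?lee_fin.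
Qed.

Let Gh_off y : y != x0 -> G y = h y.
Proof.
move=> yx0; rewrite hE /G esum_nat_recl// /f/= (negbTE yx0) add0e.
by apply: eq_esum.
Qed.

Let hW : esum setT h = esum setT G.
Proof.
rewrite /h esum_exchange; last by move=> y z; rewrite mule_ge0// lee_fin.
apply: eq_esum => z _; rewrite esumZl//; first by rewrite jump_prob_sum mule1.
by move=> y; rewrite lee_fin.
Qed.

(** Away from [x0] this is the recursion defining [taboo]. At [x0] it follows from mass
    conservation: the jump chain is stochastic, so [G] and [h] have equal totals, and the finite
    mass off [x0] cancels. No return probability has to be computed. *)
Let Gh y : G y = h y.
Proof.
have [->|] := eqVneq y x0; last exact: Gh_off.
have off : esum (~` [set x0]) h = esum (~` [set x0]) G.
  by apply: eq_esum => z /eqP zx; exact/esym/Gh_off.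
have := hW; rewrite (esumID [set x0] setT h)// (esumID [set x0] setT G)//.
rewrite !setTI !esum_set1// off.
have fin : esum (~` [set x0]) G \is a fin_num.
  rewrite ge0_fin_numE; last by apply: esum_ge0 => z _; exact: G0.
  apply: le_lt_trans GW.
  by rewrite (esumID [set x0] setT G)// !setTI leeDr// esum_ge0// => z _; exact: G0.
by move/(congr1 (fun a => a - esum (~` [set x0]) G)%E); rewrite !addeK.
Qed.

(** [G y] is the mean number of visits to [y] in a cycle; dividing by the exit rate turns it into
    mean time spent there. The normalising constant [c] is the mean cycle length. *)
Lemma taboo_stationary : exists pi, stationary_distribution rate pi.
Proof.
have Gfin y : G y \is a fin_num by rewrite ge0_fin_numE// esum_ltyP.
pose g y := fine (G y).
have g0 y : 0 <= g y by rewrite fine_ge0.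
have gE y : (g y)%:E = G y by rewrite fineK.
have gEoo : (esum setT (fun y => (g y / E y)%:E) < +oo)%E.
  apply: (@le_lt_trans _ _ (esum setT (fun y => (e1^-1)%:E * G y)%E)).
    apply: le_esum => y _; rewrite -gE -EFinM lee_fin mulrC ler_wpM2r//.
    by rewrite lef_pV2 ?posrE//; case/andP: (exit_bounds y).
  by rewrite esumZl//; [apply: lte_mul_pinfty => //|]; rewrite lee_fin invr_ge0 ltW.
have gE0 y : 0 <= g y / E y by rewrite divr_ge0// ltW.
pose c := fine (esum setT (fun y => (g y / E y)%:E)).
have cE : (c%:E = esum setT (fun y => (g y / E y)%:E))%E.
  by rewrite fineK// ge0_fin_numE// esum_ge0// => y _; rewrite lee_fin.
have c0 : 0 < c.
  rewrite -lte_fin cE; apply: lt_le_trans (esum_le_term x0 _); last first.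
    by move=> y; rewrite lee_fin.
  by rewrite lte_fin divr_gt0// -lte_fin gE Gx0.
exists (fun y => c^-1 * (g y / E y)); split.
- by move=> x; rewrite mulr_ge0// invr_ge0 ltW.
- under eq_esum do rewrite EFinM.
  rewrite esumZl -?cE ?lee_fin ?invr_ge0 ?(ltW c0)//.
  by rewrite -EFinM mulVf// gt_eqF.
- move=> y; rewrite esum_rate_jump.
  transitivity (c^-1%:E * h y)%E.
    by rewrite -Gh -gE -EFinM -mulrA divfK// gt_eqF.
  rewrite -esumZl; last 2 first.
  + by rewrite lee_fin invr_ge0 ltW.
  + by move=> z; rewrite mule_ge0// lee_fin.
  apply: eq_esum => z _; rewrite -gE -!EFinM mulrA; congr (_ * _)%:E.
  by rewrite -mulrA divfK// gt_eqF.
Qed.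

End Occupation.

Hypothesis connected : rate_connected.

Lemma invariant_gt0 nu x y : invariant nu -> 0 < nu x -> 0 < nu y.
Proof.
move=> [nu0 nuP] nux; have [s ps <-] := connected x y.
elim: s x nux ps => [//|z s IH] x nux /= /andP[/andP[zx rxz] ps].
apply: IH ps; rewrite -lte_fin nuP; apply: lt_le_trans (esum_le_term x _).
  rewrite lte_fin mulr_gt0// /jump_prob (negbTE zx) divr_gt0//.
by move=> u; rewrite lee_fin mulr_ge0.
Qed.

Lemma stationary_gt0 pi x : stationary_distribution rate pi -> 0 < pi x.
Proof.
move=> pis; have [pi0 pi1 _] := pis; have inv := stationary_invariant pis.
suff : 0 < pi x * E x by rewrite pmulr_lgt0.
have [y piy] : exists y, 0 < pi y.
  apply: contrapT => h; move: pi1; rewrite esum1; last first.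
    move=> y _; congr (_%:E); apply/eqP; rewrite eq_le pi0 andbT leNgt.
    by apply/negP => ?; apply: h; exists y.
  by move/eqP; rewrite eqe eq_sym oner_eq0.
apply: (@invariant_gt0 (fun x => pi x * E x) y x inv).
by rewrite mulr_gt0.
Qed.

(** One step of the chain maps the minimum below both measures, hence below itself, while keeping
    its total mass. As that mass is finite, equality holds pointwise. *)
Lemma invariant_min nu nu' : invariant nu -> invariant nu' ->
  (esum setT (fun x => (nu x)%:E) < +oo)%E ->
  invariant (fun x => Num.min (nu x) (nu' x)).
Proof.
move=> [nu0 nuP] [nu'0 nu'P] nuoo; pose m x := Num.min (nu x) (nu' x).
have m0 x : 0 <= m x by rewrite le_min nu0 nu'0.
split=> // y; apply/esym.
pose a y := esum setT (fun x => (m x * Pj x y)%:E).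
have a0 z : (0 <= a z)%E by apply: esum_ge0 => x _; rewrite lee_fin mulr_ge0.
apply: (@eq_of_esum R S a (fun y => (m y)%:E)) => //.
- move=> z; rewrite /m EFin_min le_min nuP nu'P; apply/andP; split.
    by apply: le_esum => x _; rewrite lee_fin ler_wpM2r// ge_min lexx.
  by apply: le_esum => x _; rewrite lee_fin ler_wpM2r// ge_min lexx orbT.
- apply: le_lt_trans nuoo; apply: le_esum => x _.
  by rewrite lee_fin ge_min lexx.
- rewrite /a esum_exchange; last by move=> u v; rewrite lee_fin mulr_ge0.
  apply: le_esum => x _; under eq_esum do rewrite EFinM.
  rewrite esumZl; [by rewrite jump_prob_sum mule1|by rewrite lee_fin|].
  by move=> z; rewrite lee_fin.
Qed.

Lemma invariant_sub nu m : invariant nu -> invariant m -> (forall x, m x <= nu x) ->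
  invariant (fun x => nu x - m x).
Proof.
move=> [nu0 nuP] [m0 mP] mnu; split=> [x|y]; first by rewrite subr_ge0.
have mfin : (m y)%:E \is a fin_num by [].
rewrite EFinB nuP.
rewrite (_ : esum _ _ = esum setT (fun x => ((nu x - m x) * Pj x y)%:E + (m x * Pj x y)%:E))%E.
  rewrite esumD; last 2 first.
  - by move=> x _; rewrite lee_fin mulr_ge0// subr_ge0.
  - by move=> x _; rewrite lee_fin mulr_ge0.
  by rewrite -mP addeK.
by apply: eq_esum => x _; rewrite -EFinD -mulrDl subrK.
Qed.

(** If [pi x0 <= pi' x0], subtracting the minimum of the two invariant measures from the first
    leaves an invariant measure that vanishes at [x0], hence everywhere. So [pi <= pi'], and both
    have mass 1. *)
Lemma stationary_unique pi pi' : stationary_distribution rate pi ->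
  stationary_distribution rate pi' -> pi = pi'.
Proof.
have [[x0]|nS] := pselect (inhabited S); last first.
  by move=> _ _; apply/funext => x; exfalso; apply: nS.
wlog le0 : pi pi' / pi x0 <= pi' x0 => [wl|] pis pis'.
  have [/wl|/ltW/wl] := leP (pi x0) (pi' x0); first exact.
  by move=> e; rewrite e.
have [pi0 pi1 _] := pis; have [pi'0 pi'1 _] := pis'.
have inv := stationary_invariant pis; have inv' := stationary_invariant pis'.
have sum_fin : (esum setT (fun x => (pi x * E x)%:E) < +oo)%E.
  apply: (@le_lt_trans _ _ (esum setT (fun x => e2%:E * (pi x)%:E)%E)).
    apply: le_esum => x _; rewrite -EFinM lee_fin mulrC ler_wpM2r//.
    by case/andP: (exit_bounds x).
  by rewrite esumZl ?pi1 ?mule1 ?ltry ?lee_fin// ltW// (e2_gt0 x0).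
have invm := invariant_min inv inv' sum_fin.
have ge_min_l x : Num.min (pi x * E x) (pi' x * E x) <= pi x * E x.
  by rewrite ge_min lexx.
have invd := invariant_sub inv invm ge_min_l.
have le x : pi x <= pi' x.
  rewrite leNgt; apply/negP => lt.
  have : 0 < pi x * E x - Num.min (pi x * E x) (pi' x * E x).
    by rewrite subr_gt0 gt_min orbC ltr_pM2r// lt.
  move=> /(@invariant_gt0 _ x x0 invd).
  by rewrite min_l ?subrr ?ltxx// ler_pM2r.
apply/funext => x; apply: EFin_inj.
apply: (@eq_of_esum R S (fun x => (pi x)%:E) (fun x => (pi' x)%:E)) => //.
- by rewrite pi'1 ltry.
- by rewrite pi1 pi'1.
Qed.

End InvariantMeasures.

(** * Irreducibility from paths of positive rates *)

Section Irreducibility.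
Context {R : realType} {S : countType} {d : measure_display} {T : measurableType d}.
Variables (rate : S -> S -> R) (P : S -> probability T R).
Variables (X : nat -> T -> S) (H : nat -> T -> R).
Hypothesis exit_gt0 : forall x, 0 < exit_rate rate x.
Hypothesis hX : forall x, markov_jump_process rate (P x) X H x.

Lemma irreducible_of_connected : rate_connected rate -> irreducible_process P X.
Proof.
move=> connected x y; have [s ps lst] := connected x y.
have [mX _ H0 /(_ (size s) (nth x (x :: s)) (fun=> 0)) law] := hX x.
apply: (@lt_le_trans _ _ (P x [set w | forall i, (i <= size s)%N ->
    X i w = nth x (x :: s) i /\ 0 < H i w])); last first.
  apply: le_measure; rewrite ?inE.
  - rewrite (_ : mkset _ = \bigcap_i (if (i <= size s)%N
        then X i @^-1` [set nth x (x :: s) i] else setT)).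
      by apply: bigcapT_measurable => i; case: ifP.
    apply/seteqP; split => w h i; first by move=> _; case: ifP => // /h[].
    by move=> si; have := h i Logic.I; rewrite si; split.
  - rewrite (_ : mkset _ = \bigcup_n X n @^-1` [set y]).
      exact: bigcupT_measurable.
    by apply/seteqP; split => w [n]; [exists n|move=> _; exists n].
  - move=> w /(_ (size s) (leqnn _))[Xs _]; exists (size s); rewrite Xs -lst.
    by rewrite -last_nth.
rewrite law// lte_fin eqxx mul1r mulr_gt0//; apply: prodr_gt0 => i _; last first.
  exact: expR_gt0.
have /andP[ne r0] := pathP x ps i (ltn_ord i).
by rewrite /jump_prob /= (negbTE ne) divr_gt0.
Qed.

End Irreducibility.
(** * Transition rates of the queue *)

Section CoxRates.
Context {R : realType}.
Variables (k : nat) (hk : (0 < k)%N) (lam q : nat -> R) (mu : R) (b : nat).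
Variable p : nat -> R.
Hypothesis hpar : cox_batch_params k lam q mu b p.

Let o : 'I_k := Ordinal hk.
Let rate := cox_rate (k := k) lam q mu b p.

Lemma cox_lam_gt0 i : (i < k)%N -> 0 < lam i.
Proof. by case: hpar => h *; exact: h. Qed.
Let lam_gt0 := cox_lam_gt0.

Lemma cox_q_bounds i : (i < k)%N -> 0 <= q i <= 1.
Proof.
case: hpar => _ q01 ql _ _; rewrite leq_eqVlt => /orP[/eqP ik|/q01/andP[/ltW -> ->//]].
by move: ql; rewrite -ik/= => ->; rewrite lexx ler01.
Qed.
Let q_bounds := cox_q_bounds.

Lemma cox_mu_gt0 : 0 < mu. Proof. by case: hpar. Qed.
Let mu_gt0 := cox_mu_gt0.

Lemma cox_p_ge0 j : (1 <= j < b.+1)%N -> 0 <= p j.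
Proof. by case: hpar => _ _ _ _ [h _]; exact: h. Qed.
Let p_ge0 := cox_p_ge0.

Lemma cox_p_sum : \sum_(1 <= j < b.+1) p j = 1. Proof. by case: hpar => _ _ _ _ []. Qed.
Let p_sum := cox_p_sum.

(** In the last phase this returns [i] itself, which is harmless since it always comes with the
    factor [q i = 0]. *)
Definition next_phase (i : 'I_k) : 'I_k := insubd i i.+1.

Lemma val_next_phase (i : 'I_k) : (i.+1 < k)%N -> next_phase i = i.+1 :> nat.
Proof. by move=> ik; rewrite val_insubd ik. Qed.

(** Truncated subtraction sends all batches with [j >= m] to level 0, which merges the two service
    cases of [cox_rate] into one sum of point masses. *)
Lemma cox_rateE m i y : rate (m, i) y =
  q i * lam i * (y == (m, next_phase i))%:R
  + (1 - q i) * lam i * (y == (m.+1, o))%:R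
  + \sum_(1 <= j < b.+1) (0 < m)%N%:R * mu * p j * (y == ((m - j)%N, i))%:R.
Proof.
case: y => m' i'; rewrite /rate /cox_rate !xpair_eqE; congr (_ + _ + _).
- have [ik|ki] := ltnP i.+1 k.
    by rewrite -[i' == next_phase i]val_eqE /= val_next_phase//; case: ifP; rewrite ?mulr1 ?mulr0.
  have -> : q i = 0.
    case: hpar => _ _ ql _ _; rewrite -ql; congr q.
    by apply/eqP; rewrite eqn_leq -ltnS prednK// ltn_ord /= -ltnS prednK.
  by rewrite !mul0r if_same.
- by rewrite -[i' == o]val_eqE/=; case: ifP; rewrite ?mulr1 ?mulr0.
- have [<-|ne] := eqVneq i' i; last first.
    by rewrite andbF big1// => j _; rewrite xpair_eqE (negbTE ne) andbF mulr0.
  rewrite andbT; case: ltnP => mm.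
    have m0 : (0 < m)%N by exact: leq_ltn_trans mm.
    rewrite m0; case: eqVneq => [->|m'0].
      rewrite mulr_sumr big_mkcond/=; apply: eq_bigr => j _.
      by rewrite mul1r xpair_eqE eqxx andbT eq_sym subn_eq0; case: ifP; rewrite ?mulr1 ?mulr0.
    have eqj j : ((m', i') == ((m - j)%N, i')) = (j == m - m')%N.
      by rewrite xpair_eqE eqxx andbT; apply/eqP/eqP; lia.
    case: leqP => mb; last first.
      rewrite big_nat_cond big1// => j /andP[/andP[_ jb] _].
      by rewrite eqj ltn_eqF ?mulr0// (leq_trans jb).
    rewrite (bigD1_seq (m - m')%N) ?iota_uniq//=; last first.
      by rewrite mem_index_iota subn_gt0 mm ltnS.
    rewrite eqj eqxx !mulr1 mul1r big1 ?addr0// => j jm.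
    by rewrite eqj (negbTE jm) mulr0.
  rewrite big_nat_cond big1// => j /andP[/andP[j0 jb] _].
  case: (posnP m) => [->|m0]; first by rewrite !mul0r.
  by rewrite xpair_eqE eqxx andbT gtn_eqF ?mulr0//; lia.
Qed.

Lemma cox_rate_ge0 x y : 0 <= rate x y.
Proof.
case: x => m i; rewrite cox_rateE; have /andP[q0 q1] := q_bounds (ltn_ord i).
have l0 := ltW (lam_gt0 (ltn_ord i)).
rewrite !addr_ge0 ?mulr_ge0 ?subr_ge0//.
rewrite big_nat_cond sumr_ge0// => j /andP[/p_ge0 pj _].
by rewrite !mulr_ge0// ltW.
Qed.

Lemma cox_rate_diag x : rate x x = 0.
Proof.
case: x => m i; rewrite /rate /cox_rate eqxx/= ltnn/= !addr0.
by rewrite [(i == i.+1 :> nat)]ltn_eqF// [(m == m.+1)]ltn_eqF// addr0.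
Qed.

(** The off-diagonal part of the generator: with [f = 1] it gives the exit rates, with the truncated
    level it gives the drift. *)
Lemma cox_generator (f : nat * 'I_k -> R) m i : (forall x, 0 <= f x) ->
  esum setT (fun y => (rate (m, i) y * f y)%:E) =
  (q i * lam i * f (m, next_phase i) + (1 - q i) * lam i * f (m.+1, o)
   + (0 < m)%N%:R * mu * \sum_(1 <= j < b.+1) p j * f ((m - j)%N, i))%:E.
Proof.
move=> f0; have /andP[q0 q1] := q_bounds (ltn_ord i).
have l0 := ltW (lam_gt0 (ltn_ord i)).
have delta c z : 0 <= c ->
    esum setT (fun y => (c * (y == z)%:R * f y)%:E) = (c * f z)%:E.
  move=> c0; rewrite (@esum_delta _ _ z) ?eqxx ?mulr1//.
    by rewrite lee_fin mulr_ge0.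
  by move=> y /negbTE ->; rewrite mulr0 mul0r.
transitivity (esum setT (fun y => (q i * lam i * (y == (m, next_phase i))%:R * f y)%:E
  + ((1 - q i) * lam i * (y == (m.+1, o))%:R * f y)%:E
  + \sum_(1 <= j < b.+1 | (1 <= j < b.+1)%N)
      ((0 < m)%N%:R * mu * p j * (y == ((m - j)%N, i))%:R * f y)%:E))%E.
  apply: eq_esum => y _; rewrite cox_rateE -!EFinD sumEFin -EFinD !mulrDl mulr_suml.
  by rewrite [in LHS]big_nat_cond; under eq_bigl do rewrite andbT.
have t0 c z y : 0 <= c -> 0 <= c * (y == z :> nat * 'I_k)%:R * f y.
  by move=> c0; rewrite !mulr_ge0.
rewrite !esumD; last 4 first.
- by move=> y _; rewrite lee_fin t0 ?mulr_ge0.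
- by move=> y _; rewrite lee_fin t0 ?mulr_ge0 ?subr_ge0.
- by move=> y _; rewrite -EFinD lee_fin addr_ge0// t0 ?mulr_ge0 ?subr_ge0.
- move=> y _; apply: sume_ge0 => j /p_ge0 pj; rewrite lee_fin t0// !mulr_ge0//.
  exact: ltW.
rewrite !delta ?mulr_ge0 ?subr_ge0// esum_sum; last first.
  by move=> y j _ /p_ge0 pj; rewrite lee_fin t0// !mulr_ge0// ltW.
rewrite -EFinD; under eq_bigr => j /p_ge0 pj.
  rewrite delta; last by rewrite !mulr_ge0// ltW.
  over.
rewrite sumEFin -EFinD mulr_sumr; congr (_ + _)%:E.
rewrite [RHS]big_nat_cond; under [RHS]eq_bigl do rewrite andbT.
by apply: eq_bigr => j _; rewrite !mulrA.
Qed.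

Lemma cox_exit_rate_esum m i :
  esum [set~ (m, i)] (fun y => (rate (m, i) y)%:E) = (lam i + (0 < m)%N%:R * mu)%:E.
Proof.
rewrite esum_setC1; transitivity (esum setT (fun y => (rate (m, i) y * cst 1 y)%:E)).
  by apply: eq_esum => y _; case: eqP => [->|_]; rewrite ?cox_rate_diag ?mul0r ?mulr1.
rewrite cox_generator//; congr (_%:E).
have sp1 : \sum_(1 <= j < b.+1) p j * 1 = 1.
  by rewrite -[RHS]p_sum; apply: eq_bigr => j _; rewrite mulr1.
by rewrite /= sp1 !mulr1 -mulrDl [q i + _]addrC subrK mul1r.
Qed.

Lemma cox_exit_rateE m i : exit_rate rate (m, i) = lam i + (0 < m)%N%:R * mu.
Proof. by rewrite /exit_rate cox_exit_rate_esum. Qed.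

Lemma cox_exit_sum x : (exit_rate rate x)%:E = esum [set~ x] (fun y => (rate x y)%:E).
Proof. by case: x => m i; rewrite cox_exit_rateE cox_exit_rate_esum. Qed.

(** Stands in for the least [lam i]: each inverse is one term of the sum, so this is a positive
    number below all of them. *)
Definition cox_exit_lo : R := (\sum_(i < k) (lam i)^-1)^-1.
Definition cox_exit_hi : R := \sum_(i < k) lam i + mu.

Let sum_inv_ge (i : 'I_k) : (lam i)^-1 <= \sum_(i < k) (lam i)^-1.
Proof.
rewrite (bigD1 i)//= lerDl sumr_ge0// => j _.
by rewrite invr_ge0 ltW// lam_gt0.
Qed.

Lemma cox_exit_lo_gt0 : 0 < cox_exit_lo.
Proof.
by rewrite invr_gt0; apply: lt_le_trans (sum_inv_ge o); rewrite invr_gt0 lam_gt0.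
Qed.

Lemma cox_exit_bounds x : cox_exit_lo <= exit_rate rate x <= cox_exit_hi.
Proof.
case: x => m i; rewrite cox_exit_rateE; have li := lam_gt0 (ltn_ord i).
apply/andP; split.
  apply: (@le_trans _ _ (lam i)); last by rewrite lerDl mulr_ge0// ltW.
  rewrite -[leRHS]invrK lef_pV2 ?posrE ?invr_gt0//.
  by apply: lt_le_trans (sum_inv_ge i); rewrite invr_gt0.
apply: lerD; last by case: (0 < m)%N; rewrite ?mul1r ?mul0r// ltW.
by rewrite (bigD1 i)//= lerDl sumr_ge0// => j _; rewrite ltW// lam_gt0.
Qed.

(** Route: empty the system, run the phases up to an arrival, serve that customer to reach [(0, o)],
    let [m'] customers arrive, then advance to phase [i']. *)
Lemma cox_connected : rate_connected rate.
Proof.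
pose e x y := (y != x) && (0 < rate x y).
pose reach x y := exists2 s, path e x s & last x s = y.
have reach_refl x : reach x x by exists [::].
have reach_trans y x z : reach x y -> reach y z -> reach x z.
  move=> [s ps <-] [t pt <-]; exists (s ++ t); rewrite ?last_cat//.
  by rewrite cat_path ps.
have reach_step x y : y != x -> 0 < rate x y -> reach x y.
  by move=> yx r; exists [:: y] => //=; rewrite /e yx r.
have up_phase m (i : 'I_k) (ik : (i.+1 < k)%N) : reach (m, i) (m, Ordinal ik).
  apply: reach_step; first by rewrite xpair_eqE eqxx -val_eqE/= gtn_eqF.
  rewrite /rate /cox_rate/= !eqxx/= ltnn/= addr0 (ltn_eqF (ltnSn m))/= addr0.
  by rewrite mulr_gt0 ?lam_gt0//; case: hpar => _ /(_ _ ik)/andP[].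
have from0 m (i : 'I_k) : reach (m, o) (m, i).
  case: i => i ik; elim: i ik => [|i IH] ik.
    by rewrite (_ : Ordinal ik = o)//; exact: val_inj.
  apply: reach_trans (IH (ltnW ik)) _.
  exact: (up_phase m (Ordinal (ltnW ik)) ik).
(* With [q i = 1] no arrival can occur in phase [i], so the path climbs to the last phase, where [q]
   vanishes. *)
have arrive m (i : 'I_k) : reach (m, i) (m.+1, o).
  have [n] := ubnP (k - i); elim: n i => // n IH i ni.
  have [ik|ki] := ltnP i.+1 k.
    apply: reach_trans (up_phase m i ik) _; apply: IH => /=.
    by move: ni ik; lia.
  have ql : q i = 0.
    case: hpar => _ _ ql _ _; rewrite -ql; congr q.
    by move: (ltn_ord i) ki; lia.
  apply: reach_step; first by rewrite xpair_eqE gtn_eqF.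
  rewrite /rate /cox_rate/= !eqxx/= ltnNge leqnSn/= addr0 ql subr0 mul1r.
  by rewrite (gtn_eqF (ltnSn m))/= add0r lam_gt0.
have [j /andP[j0 jb] pj] : exists2 j, (1 <= j < b.+1)%N & 0 < p j.
  apply: contrapT => h; move/eqP: p_sum; rewrite big_nat_cond big1 ?(eq_sym 0) ?oner_eq0//.
  move=> j /andP[jb _]; apply/eqP; rewrite eq_le p_ge0// andbT leNgt.
  by apply/negP => ?; apply: h; exists j.
have down m (i : 'I_k) : reach (m, i) (0%N, i).
  have [n] := ubnP m; elim: n m => // n IH m mn.
  case: (posnP m) => [->//|m0].
  apply: (@reach_trans ((m - j)%N, i)); last by apply: IH; move: j0 m0 mn; lia.
  apply: reach_step; first by rewrite xpair_eqE eqxx andbT; move: j0 m0; lia.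
  rewrite cox_rateE; have /andP[q0 q1] := q_bounds (ltn_ord i).
  have l0 := ltW (lam_gt0 (ltn_ord i)).
  apply: ltr_wpDl; first by rewrite addr_ge0 ?mulr_ge0 ?subr_ge0.
  rewrite (bigD1_seq j) ?iota_uniq ?mem_index_iota ?j0//= eqxx m0 mulr1 mul1r.
  apply: ltr_pwDl; first by rewrite mulr_gt0.
  rewrite big_nat_cond sumr_ge0// => l /andP[/p_ge0 pl _].
  by rewrite !mulr_ge0// ltW.
move=> [m i] [m' i']; change (reach (m, i) (m', i')).
apply: (reach_trans _ _ _ (down m i)); apply: (reach_trans _ _ _ (arrive 0%N i)).
apply: (reach_trans _ _ _ (down 1%N o)); apply: (reach_trans _ _ _ _ (from0 m' i')).
by elim: m' => // m' IH; exact: reach_trans IH (arrive m' o).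
Qed.

End CoxRates.

(** * Inflow into a state of the queue *)

Section CoxInflow.
Context {R : realType}.
Variables (k : nat) (hk : (0 < k)%N) (lam q : nat -> R) (mu : R) (b : nat).
Variable p : nat -> R.
Hypothesis hpar : cox_batch_params k lam q mu b p.
Let rate := cox_rate (k := k) lam q mu b p.

Definition batch_tail (l : nat) : R := \sum_(1 <= j < b.+1 | (l <= j)%N) p j.

(** The sources are sorted by kind of transition: [t1] phase completions, [t2] arrivals, [t3]
    services. Level 0 collects the whole tail of the batch law because a batch never takes more
    customers than are present. *)
Lemma cox_inflow (a : nat -> nat -> R) m (i : 'I_k) : (forall m (i : 'I_k), 0 <= a m i) ->
  esum setT (fun x : nat * 'I_k => (a x.1 x.2 * rate x (m, i))%:E) =
  ((if i : nat is j.+1 then a m j * (q j * lam j)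
    else if m is n.+1 then \sum_(j < k) a n j * ((1 - q j) * lam j) else 0)
   + mu * \sum_(1 <= l < b.+1)
       a (m + l)%N i * (if m == 0%N then batch_tail l else p l))%:E.
Proof.
move=> a0.
have q0 (j : 'I_k) : 0 <= q j by case/andP: (cox_q_bounds hpar (ltn_ord j)).
have q1 (j : 'I_k) : 0 <= 1 - q j.
  by rewrite subr_ge0; case/andP: (cox_q_bounds hpar (ltn_ord j)).
have l0 (j : 'I_k) : 0 <= lam j by rewrite ltW// (cox_lam_gt0 hpar).
have mu0 := cox_mu_gt0 hpar.
have p0 j : (1 <= j < b.+1)%N -> 0 <= p j by exact: (cox_p_ge0 hpar).
have tail0 l : 0 <= batch_tail l.
  by rewrite /batch_tail big_nat_cond sumr_ge0// => j /andP[/p0].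
pose t1 (x : nat * 'I_k) := if (m == x.1) && (i == x.2.+1 :> nat)
  then a x.1 x.2 * (q x.2 * lam x.2) else 0.
pose t2 (x : nat * 'I_k) := if (m == x.1.+1) && (i == 0%N :> nat)
  then a x.1 x.2 * ((1 - q x.2) * lam x.2) else 0.
pose t3 (x : nat * 'I_k) := if (m < x.1 < m + b.+1)%N && (i == x.2)
  then a x.1 x.2 * (mu * (if m == 0%N then batch_tail (x.1 - m) else p (x.1 - m)%N)) else 0.
have t10 x : (0 <= (t1 x)%:E)%E.
  by rewrite lee_fin /t1; case: ifP => // _; rewrite !mulr_ge0.
have t20 x : (0 <= (t2 x)%:E)%E.
  by rewrite lee_fin /t2; case: ifP => // _; rewrite !mulr_ge0.
have t30 x : (0 <= (t3 x)%:E)%E.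
  rewrite lee_fin /t3; case: ifP => // /andP[/andP[h1 h2] _].
  rewrite !mulr_ge0// ?(ltW mu0)//; case: ifP => // _.
  by apply: p0; apply/andP; split; lia.
transitivity (esum setT (fun x => (t1 x)%:E + (t2 x)%:E + (t3 x)%:E)%E).
  apply: eq_esum => -[n j] _; rewrite -!EFinD; congr (_%:E).
  rewrite /t1 /t2 /t3 /rate /cox_rate /= !mulrDr; congr (_ + _ + _).
  - by case: ifP => // _; rewrite mulr0.
  - by case: ifP => // _; rewrite mulr0.
  - case: ltnP => mn /=; last by rewrite mulr0.
    have [ij|_] := eqVneq i j; last by rewrite andbF mulr0.
    rewrite andbT; have [->|m0] := eqVneq m 0%N.
      rewrite add0n ltnS subn0; case: leqP => // bn.
      rewrite big_nat_cond [X in mu * X]big1 ?mulr0// => l.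
      by move=> /andP[/andP[_ lb] nl]; lia.
    have -> : (n < m + b.+1)%N = (n - m <= b)%N by apply/idP/idP; lia.
    by case: ifP; rewrite ?mulr0.
rewrite !esumD//; last by move=> x _; exact: adde_ge0.
rewrite [X in (_ + X)%E](@esum_fin_support _ _ [seq ((m + l)%N, i) | l <- index_iota 1 b.+1])//; last 2 first.
- by rewrite map_inj_uniq ?iota_uniq// => u v [] /addnI.
- move=> [n j] nin; congr (_%:E); rewrite /t3 /=; case: ifP => // /andP[/andP[h1 h2] /eqP ij].
  exfalso; move/negP: nin; apply; apply/mapP; exists (n - m)%N; last first.
    by rewrite ij subnKC// ltnW.
  by rewrite mem_index_iota; lia.
rewrite big_map sumEFin.
have -> : \sum_(l <- index_iota 1 b.+1) t3 ((m + l)%N, i) =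
    mu * \sum_(1 <= l < b.+1) a (m + l)%N i * (if m == 0%N then batch_tail l else p l).
  rewrite mulr_sumr; apply: eq_big_nat => l /andP[l1 lb].
  rewrite /t3/= eqxx andbT ltn_add2l lb -[X in (X < _)%N]addn0 ltn_add2l l1/=.
  by rewrite addKn mulrCA.
rewrite [RHS]EFinD; congr (_ + _)%E.
case: i @t1 @t2 @t3 t10 t20 t30 => -[|i] ik t1 t2 t3 t10 t20 t30 /=.
  rewrite [X in (X + _)%E]esum1 ?add0e; last by move=> [n j] _; rewrite /t1 andbF.
  case: m @t1 @t2 @t3 t10 t20 t30 => [|m] t1 t2 t3 t10 t20 t30.
    by rewrite esum1// => -[n j] _.
  rewrite (@esum_fin_support _ _ [seq (m, j) | j <- enum 'I_k])//; last 2 first.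
  - by rewrite map_inj_uniq ?enum_uniq// => u v [].
  - move=> [n j] nin; rewrite /t2/= eqSS andbT; case: eqP => // mn.
    exfalso; move/negP: nin; apply; apply/mapP; exists j; rewrite ?mn//.
    by rewrite mem_enum.
  rewrite big_map big_enum/= sumEFin; congr (_%:E); apply: eq_bigr => j _.
  by rewrite /t2/= eqxx.
rewrite [X in (_ + X)%E]esum1 ?adde0; last by move=> [n j] _; rewrite /t2 andbF.
have ik' := ltnW ik.
rewrite (@esum_delta _ _ (m, Ordinal ik'))//; first by rewrite /t1/= !eqxx.
move=> [n j] ne; congr (_%:E); rewrite /t1/=; case: ifP => // /andP[/eqP mn].
rewrite eqSS => /eqP ij; exfalso; move/eqP: ne; apply.
by rewrite mn; congr (_, _); exact: val_inj.
Qed.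

End CoxInflow.
(** * The product formula *)

Section CoxFormula.
Context {R : realType}.
Variables (k : nat) (hk : (0 < k)%N) (lam q : nat -> R) (mu : R) (b : nat).
Variable p : nat -> R.
Hypothesis hpar : cox_batch_params k lam q mu b p.
Let rate := cox_rate (k := k) lam q mu b p.
Let o : 'I_k := Ordinal hk.
Let phi := phiY b p.
Let lam_gt0 := cox_lam_gt0 hpar.
Let q_bounds := cox_q_bounds hpar.
Let mu_gt0 := cox_mu_gt0 hpar.
Let p_ge0 := cox_p_ge0 hpar.
Let p_sum := cox_p_sum hpar.

(** Every batch has size at least 1, so this holds term by term. It keeps the denominators of
    [alpha] positive. *)
Lemma phiY_le x : 0 <= x <= 1 -> phi x <= x.
Proof.
move=> /andP[x0 x1]; rewrite -[leRHS]mul1r -p_sum mulr_suml.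
apply: ler_sum_nat => j /[dup] jb /p_ge0 pj; rewrite ler_wpM2l//.
by case: j jb {pj} => // j _; rewrite exprS ler_piMr// exprn_ile1.
Qed.

(* Relative weight of phase [i] on every level [m >= 1]. *)
Definition phase_weight x i : R := \prod_(1 <= l < i.+1) (q l.-1 * alpha lam mu b p x l).

Let A := phase_weight.

Lemma phase_weight0 x : A x 0 = 1.
Proof. by rewrite /A /phase_weight big_geq. Qed.

(** The balance equation of phase [i + 1] on a level [m >= 1] after removing the geometric factor;
    [mu * phi x] is what services from higher levels bring back. *)
Lemma phase_weightS x i : 0 <= x <= 1 -> (i.+1 < k)%N ->
  A x i.+1 * (lam i.+1 + mu * (1 - phi x)) = q i * lam i * A x i.
Proof.
move=> x01 ik; have x0 : 0 <= x by case/andP: x01.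
rewrite /A /phase_weight big_nat_recr//= /alpha.
have -> : lam i.+1 + mu - mu * phiY b p x = lam i.+1 + mu * (1 - phi x).
  by rewrite -/phi; ring.
have lt0 : 0 < lam i.+1 + mu * (1 - phi x).
  rewrite ltr_pwDl ?lam_gt0// mulr_ge0 ?(ltW mu_gt0)// subr_ge0.
  by rewrite (le_trans (phiY_le x01))//; case/andP: x01.
rewrite -!mulrA mulVf ?gt_eqF// mulr1; ring.
Qed.

Lemma phase_weight_gt0 x i : 0 <= x <= 1 -> (i < k)%N -> 0 < A x i.
Proof.
move=> x01; elim: i => [|i IH] ik; first by rewrite phase_weight0.
have lt0 : 0 < lam i.+1 + mu * (1 - phi x).
  rewrite ltr_pwDl ?lam_gt0// mulr_ge0 ?(ltW mu_gt0)// subr_ge0.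
  by rewrite (le_trans (phiY_le x01))//; case/andP: x01.
rewrite -(pmulr_lgt0 _ lt0) phase_weightS// mulr_gt0 ?IH ?(ltnW ik)//.
rewrite mulr_gt0 ?lam_gt0 ?(ltnW ik)//.
by case: hpar => _ /(_ _ ik)/andP[].
Qed.

Lemma phase_weight_ge0 x i : 0 <= x <= 1 -> (i < k)%N -> 0 <= A x i.
Proof. by move=> x01 ik; rewrite ltW// phase_weight_gt0. Qed.

(** Adding up [phase_weightS] telescopes, and the end term vanishes because [q k.-1 = 0]. *)
Lemma sum_phase_weight x : 0 <= x <= 1 ->
  mu * (1 - phi x) * \sum_(0 <= i < k) A x i =
  lam 0%N + mu * (1 - phi x) - \sum_(0 <= i < k) A x i * (1 - q i) * lam i.
Proof.
move=> x01; set s := mu * _.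
have main n : (n < k)%N -> s * \sum_(0 <= i < n.+1) A x i = lam 0%N + s
    - \sum_(0 <= i < n.+1) A x i * (1 - q i) * lam i - q n * lam n * A x n.
  elim: n => [|n IH] nk; first by rewrite !big_nat1 phase_weight0; ring.
  rewrite !(@big_nat_recr _ _ _ n.+1)//= mulrDr IH ?(ltnW nk)//.
  by rewrite -(phase_weightS x01 nk) -/s; ring.
have := main k.-1; rewrite prednK// => ->//.
have ql : q k.-1 = 0 by case: hpar.
by rewrite ql !mul0r subr0.
Qed.

(** [sum_phase_weight] eliminates the arrival sum from F. In this form both sides visibly carry the
    factor [1 - x], which also divides [1 - phi x]. *)
Lemma coxF_fixpoint x : 0 <= x <= 1 ->
  (x = coxF k lam q mu b p x) <->
  mu * (1 - phi x) * \sum_(0 <= i < k) A x i = (1 - x) * (lam 0%N + mu * (1 - phi x)).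
Proof.
move=> x01; rewrite sum_phase_weight//.
have lm : lam 0%N + mu != 0 by rewrite gt_eqF// addr_gt0 ?lam_gt0.
have -> : coxF k lam q mu b p x =
    (\sum_(0 <= i < k) A x i * (1 - q i) * lam i + x * mu * phi x) / (lam 0%N + mu).
  rewrite /coxF; congr ((_ + _) / _); rewrite [RHS]big_ltn// phase_weight0 mul1r.
  by congr (_ + _); rewrite mulrC.
set S := \sum_(_ <= _ < _) _.
split=> [|e]; last by apply: (mulIf lm); rewrite divfK//; lra.
move/(congr1 ( *%R^~ (lam 0%N + mu))); rewrite divfK// => e; lra.
Qed.

Variable g : R.
Hypothesis g01 : 0 < g < 1.
Hypothesis gF : g = coxF k lam q mu b p g.

Let g_gt0 : 0 < g. Proof. by case/andP: g01. Qed.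
Let g_lt1 : g < 1. Proof. by case/andP: g01. Qed.
Let g01' : 0 <= g <= 1. Proof. by rewrite !ltW. Qed.

Let s := mu * (1 - phi g).
Let s_gt0 : 0 < s.
Proof. by rewrite mulr_gt0// subr_gt0 (le_lt_trans (phiY_le g01')). Qed.

Let EA := \sum_(0 <= i < k) A g i.
Let sEA : s * EA = (1 - g) * (lam 0%N + s).
Proof. exact/coxF_fixpoint. Qed.

Let sum_arrival : \sum_(0 <= i < k) A g i * (1 - q i) * lam i = g * (lam 0%N + s).
Proof. by have := sum_phase_weight g01'; rewrite -/EA -/s sEA => e; lra. Qed.

(** Both sides are the mean of the geometric sum of [g ^+ l] over [l < Y]. This value makes the
    service inflow into level 0 collapse to [c * lam 0 * A g i]. *)
Lemma sum_batch_tail :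
  \sum_(1 <= l < b.+1) g ^+ l.-1 * batch_tail b p l = (1 - phi g) / (1 - g).
Proof.
have g1 : 1 - g != 0 by rewrite subr_eq0 gt_eqF.
have -> : \sum_(1 <= l < b.+1) g ^+ l.-1 * batch_tail b p l =
    \sum_(1 <= j < b.+1) p j * ((1 - g ^+ j) / (1 - g)).
  rewrite /batch_tail; under eq_bigr do rewrite big_mkcond mulr_sumr/=.
  rewrite exchange_big_nat/=; apply: eq_big_nat => j /andP[j1 jb].
  have -> : (1 - g ^+ j) / (1 - g) = \sum_(1 <= l < j.+1) g ^+ l.-1.
    rewrite big_add1/= big_mkord -[1 - g ^+ j]opprB subrX1 -mulNr opprB.
    by rewrite mulrC mulKf.
  rewrite mulr_sumr (big_nat_widen _ _ _ _ _ jb) [RHS]big_mkcond/=.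
  by apply: eq_bigr => l _; rewrite ltnS; case: ifP; rewrite ?mulr0// mulrC.
have -> : 1 - phi g = \sum_(1 <= j < b.+1) p j * (1 - g ^+ j).
  by rewrite /phi /phiY -[X in X - _ = _]p_sum -sumrB; apply: eq_bigr => j _; ring.
by rewrite mulr_suml; apply: eq_bigr => j _; rewrite mulrA.
Qed.

Definition cox_pi0 : R := ((1 + lam 0%N / (mu * (1 - phi g)))
  * (1 + \sum_(1 <= i < k) lam 0%N / lam i * \prod_(0 <= j < i) q j))^-1.

(* [c] is the probability of the state (0, 0). *)
Definition cox_level (c : R) (m i : nat) : R :=
  if m is n.+1 then
    c * (lam 0%N * (1 - g) * g ^+ n / (mu * (1 - phi g))) * A g i
  else c * (lam 0%N / lam i) * (\prod_(0 <= l < i) q l)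
         * (1 + \sum_(1 <= j < i.+1) \prod_(1 <= l < j.+1) alpha lam mu b p g l).

Arguments cox_level : simpl never.

Variable c : R.
Let a := cox_level c.

(** The flow out of state [(0, i)], for which the boundary formula becomes the first-order recursion
    [uS]. *)
Let u i := a 0%N i * lam i.

Let u0 : u 0%N = c * lam 0%N.
Proof.
rewrite /u /a /cox_level !big_geq// addr0 !mulr1.
by rewrite divff ?mulr1// gt_eqF// lam_gt0.
Qed.

Let uS i : (i.+1 < k)%N -> u i.+1 = q i * u i + c * lam 0%N * A g i.+1.
Proof.
move=> ik; rewrite /u /a /cox_level.
have l1 : lam i.+1 != 0 by rewrite gt_eqF// lam_gt0.
have l2 : lam i != 0 by rewrite gt_eqF// lam_gt0// ltnW.
rewrite (@big_nat_recr _ _ _ i.+1 1)//= [\prod_(0 <= l < i.+1) q l]big_nat_recr//=.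
have -> : A g i.+1 = (\prod_(0 <= l < i.+1) q l) *
    \prod_(1 <= l < i.+2) alpha lam mu b p g l.
  rewrite /A /phase_weight (@big_split _ _ _ nat _ _ (fun l => q l.-1)) /=.
  by congr (_ * _); rewrite big_add1.
rewrite [\prod_(0 <= l < i.+1) q l]big_nat_recr//=.
by field; rewrite l1 l2.
Qed.

Let c1 := c * (lam 0%N * (1 - g) / s).

Let a_up n i : a n.+1 i = c1 * g ^+ n * A g i.
Proof. by rewrite /a /cox_level /c1 /s; congr (_ * _); rewrite -!mulrA; do 3 congr (_ * _); rewrite mulrC. Qed.

(** Arrivals leaving level 0 balance the services entering it: the recursion [uS] telescopes. *)
Let sum_u : \sum_(0 <= i < k) u i * (1 - q i) = c * lam 0%N * EA.
Proof.
have main n : (n < k)%N -> \sum_(0 <= i < n.+1) u i * (1 - q i) =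
    c * lam 0%N * \sum_(0 <= i < n.+1) A g i - q n * u n.
  elim: n => [|n IH] nk; first by rewrite !big_nat1 u0 phase_weight0; ring.
  by rewrite !(@big_nat_recr _ _ _ n.+1)//= IH ?(ltnW nk)// (uS nk); ring.
have ql : q k.-1 = 0 by case: hpar.
by have := main k.-1; rewrite prednK// => ->//; rewrite ql mul0r subr0.
Qed.

(** Level 0 reduces to [uS], phases [i >= 1] of higher levels to [phase_weightS]. The fixed-point
    equation enters only in phase 0 of the levels [m >= 1]: through [sEA] for [m = 1], where the
    arrivals come from the boundary, and through [sum_arrival] for [m >= 2]. *)
Lemma cox_level_balance m (i : 'I_k) :
  a m i * (lam i + (0 < m)%N%:R * mu) =
  (if i : nat is j.+1 then a m j * (q j * lam j)
   else if m is n.+1 then \sum_(j < k) a n j * ((1 - q j) * lam j) else 0)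
  + mu * \sum_(1 <= l < b.+1)
      a (m + l)%N i * (if m == 0%N then batch_tail b p l else p l).
Proof.
have sne : s != 0 by rewrite gt_eqF.
have g1 : 1 - g != 0 by rewrite subr_eq0 gt_eqF.
case: m => [|n].
  rewrite mul0r addr0 eqxx.
  have -> : mu * \sum_(1 <= l < b.+1) a (0 + l)%N i * batch_tail b p l =
      c * lam 0%N * A g i.
    transitivity (mu * (c1 * A g i * \sum_(1 <= l < b.+1) g ^+ l.-1 * batch_tail b p l)).
      congr (_ * _); rewrite mulr_sumr; apply: eq_big_nat => -[//|l] _.
      by rewrite add0n a_up/=; ring.
    have sE : (1 - phi g) = s / mu by rewrite /s mulrC mulKf// gt_eqF.
    rewrite sum_batch_tail sE /c1; field.
    by rewrite g1 sne gt_eqF.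
  case: i => -[|i] ik /=.
    by rewrite add0r -/(u 0) u0 phase_weight0 mulr1.
  by have := uS ik; rewrite /u /= => ->; ring.
have -> : mu * \sum_(1 <= l < b.+1) a (n.+1 + l)%N i * p l = a n.+1 i * (mu * phi g).
  rewrite /phi /phiY !mulr_sumr; apply: eq_bigr => l _.
  by rewrite addSn !a_up exprD; ring.
rewrite mul1r; case: i => -[|i] ik /=; last first.
  have -> : a n.+1 i.+1 * (lam i.+1 + mu) =
     c1 * g ^+ n * (A g i.+1 * (lam i.+1 + s)) + a n.+1 i.+1 * (mu * phi g).
    by rewrite a_up /s; ring.
  by rewrite phase_weightS// !a_up; ring.
case: n => [|n].
  have -> : \sum_(j < k) a 0%N j * ((1 - q j) * lam j) = c * lam 0%N * EA.
    rewrite -sum_u big_mkord; apply: eq_bigr => j _.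
    by rewrite /u; ring.
  rewrite !a_up phase_weight0 expr0 !mulr1 /c1.
  have -> : EA = (1 - g) * (lam 0%N + s) / s by rewrite -sEA mulrC mulKf.
  have -> : mu * phi g = mu - s by rewrite /s; ring.
  by field.
have -> : \sum_(j < k) a n.+1 j * ((1 - q j) * lam j) = c1 * g ^+ n * (g * (lam 0%N + s)).
  rewrite -sum_arrival big_mkord mulr_sumr; apply: eq_bigr => j _.
  by rewrite a_up; ring.
by rewrite !a_up phase_weight0 exprS /s; ring.
Qed.

Let Qp i := \prod_(0 <= l < i) q l.

(** The left side is the total over all levels, the geometric part having been summed. As the phase
    evolves independently of the level, this must be proportional to the stationary law of the phase
    alone. *)
Let phase_marginal i : (i < k)%N ->
  a 0%N i + c * lam 0%N / s * A g i = c * (1 + lam 0%N / s) * (lam 0%N / lam i * Qp i).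
Proof.
have sne : s != 0 by rewrite gt_eqF.
have key : (i < k)%N -> u i + lam i * (c * lam 0%N / s) * A g i
    = c * lam 0%N * (1 + lam 0%N / s) * Qp i.
  elim: i => [|i IH] ik.
    by rewrite u0 phase_weight0 /Qp big_geq//; field.
  rewrite (uS ik) /Qp big_nat_recr//= -/(Qp i).
  have -> : c * lam 0%N * (1 + lam 0%N / s) * (Qp i * q i) =
      q i * (u i + lam i * (c * lam 0%N / s) * A g i) by rewrite (IH (ltnW ik)); ring.
  have -> : q i * (u i + lam i * (c * lam 0%N / s) * A g i) =
      q i * u i + c * lam 0%N / s * (q i * lam i * A g i) by ring.
  by rewrite -(phase_weightS g01' ik) -/s; field.
move=> ik; have lne : lam i != 0 by rewrite gt_eqF// lam_gt0.
apply: (mulfI lne); transitivity (u i + lam i * (c * lam 0%N / s) * A g i).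
  by rewrite /u; ring.
by rewrite key//; field; rewrite lne.
Qed.

Let c1_ge0 : 0 <= c -> 0 <= c1.
Proof.
move=> c0; rewrite mulr_ge0// mulr_ge0 ?invr_ge0 ?(ltW s_gt0)//.
by rewrite mulr_ge0 ?subr_ge0 ?(ltW g_lt1)// ltW// lam_gt0.
Qed.

Lemma cox_level_ge0 m i : 0 <= c -> (i < k)%N -> 0 <= a m i.
Proof.
move=> c0 ik; case: m => [|m].
  suff : 0 <= u i by rewrite /u pmulr_lge0 ?lam_gt0.
  elim: i ik => [|i IH] ik; first by rewrite u0 mulr_ge0// ltW// lam_gt0.
  rewrite uS// addr_ge0//.
    by rewrite mulr_ge0 ?IH ?(ltnW ik)//; case/andP: (q_bounds (ltnW ik)).
  by rewrite !mulr_ge0 ?phase_weight_ge0// ltW// lam_gt0.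
by rewrite a_up mulr_ge0 ?phase_weight_ge0// mulr_ge0 ?c1_ge0// exprn_ge0// ltW.
Qed.

Let normal := (1 + lam 0%N / (mu * (1 - phi g)))
  * (1 + \sum_(1 <= i < k) lam 0%N / lam i * \prod_(0 <= j < i) q j).

Lemma cox_normal_gt0 : 0 < normal.
Proof.
apply: mulr_gt0; first by rewrite ltr_pwDl// divr_ge0// ltW// lam_gt0.
rewrite ltr_pwDl// big_nat_cond sumr_ge0// => i /andP[/andP[_ ik] _].
rewrite mulr_ge0 ?divr_ge0 ?(ltW (lam_gt0 _))//.
rewrite big_nat_cond prodr_ge0// => j /andP[/andP[_ ji] _].
by case/andP: (q_bounds (ltn_trans ji ik)).
Qed.

Lemma cox_level_sum : 0 <= c ->
  esum setT (fun x : nat * 'I_k => (a x.1 x.2)%:E) = (c * normal)%:E.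
Proof.
move=> c0; have age0 m (i : 'I_k) : (0 <= (a m i)%:E)%E.
  by rewrite lee_fin; exact: cox_level_ge0.
transitivity (esum setT (fun m => (\sum_(i < k) a m i)%:E)).
  transitivity (esum setT (fun m => esum setT (fun i : 'I_k => (a m i)%:E))).
    rewrite (esum_esum (I := setT) (J := fun=> setT))//.
    by congr (esum _ _); apply/seteqP; split.
  apply: eq_esum => m _; rewrite (@esum_fin_support _ _ (enum 'I_k)) ?enum_uniq//.
    by rewrite big_enum/= sumEFin.
  by move=> i; rewrite mem_enum.
rewrite esum_nat_recl; last first.
  by move=> m; rewrite lee_fin sumr_ge0// => i _; exact: cox_level_ge0.
have sne : s != 0 by rewrite gt_eqF.
have g1 : 1 - g != 0 by rewrite subr_eq0 gt_eqF.
have c10 : 0 <= c1 * EA.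
  rewrite mulr_ge0 ?c1_ge0// /EA big_nat_cond.
  by apply: sumr_ge0 => i /andP[/andP[_ ik] _]; exact: phase_weight_ge0.
transitivity ((\sum_(i < k) a 0%N i)%:E +
    (c1 * EA)%:E * esum setT (fun n => (g ^+ n)%:E))%E.
  congr (_ + _)%E; rewrite -esumZl; last 2 first.
  - by rewrite lee_fin.
  - by move=> n; rewrite lee_fin exprn_ge0// ltW.
  apply: eq_esum => n _; rewrite -EFinM; congr (_%:E).
  rewrite /EA big_mkord mulr_sumr mulr_suml; apply: eq_bigr => i _.
  by rewrite a_up; ring.
have -> : esum setT (fun n => (g ^+ n)%:E) = ((1 - g)^-1)%:E.
  have gn0 n : (0 <= (g ^+ n)%:E)%E by rewrite lee_fin exprn_ge0// ltW.
  have le : (esum setT (fun n => (g ^+ n)%:E) <= ((1 - g)^-1)%:E)%E.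
    apply: esum_nat_lim_le => // N; rewrite sumEFin lee_fin.
    have := @geometric_le_lim R N 1 g ler01 g_gt0.
    rewrite ger0_norm ?(ltW g_gt0)// mul1r => /(_ g_lt1); apply: le_trans.
    rewrite /series/= big_mkord; apply: ler_sum => i _.
    by rewrite /geometric/= mul1r.
  have fin : esum setT (fun n => (g ^+ n)%:E) \is a fin_num.
    by rewrite ge0_fin_numE ?esum_ge0//; apply: le_lt_trans le _; rewrite ltry.
  (* Once known to be finite, the sum [S] is determined by [S = 1 + g * S]. *)
  have := esum_nat_recl gn0.
  under [X in _ = (_ + X)%E -> _]eq_esum => n _ do rewrite exprS EFinM.
  rewrite esumZl// ?lee_fin ?(ltW g_gt0)// -(fineK fin) -EFinM -EFinD => -[e].
  congr (_%:E); apply: (mulfI g1); rewrite divff// mulrBl mul1r {1}e expr0; ring.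
rewrite -EFinM -EFinD; congr (_%:E).
have -> : c1 * EA * (1 - g)^-1 = \sum_(i < k) c * lam 0%N / s * A g i.
  by rewrite -mulr_sumr -(big_mkord xpredT (A g)) -/EA /c1; field; rewrite sne.
rewrite -big_split/= /normal -/s.
under eq_bigr => i _ do rewrite phase_marginal//.
rewrite -mulr_sumr -(big_mkord xpredT (fun i => lam 0%N / lam i * Qp i)) mulrA.
congr (_ * _); rewrite big_ltn// /Qp [in X in X + _]big_geq// mulr1.
by rewrite divff// gt_eqF// lam_gt0.
Qed.

End CoxFormula.

Arguments cox_level : simpl never.
(** * The fixed point equation *)

Section CoxErgodicity.
Context {R : realType}.
Variables (k : nat) (hk : (0 < k)%N) (lam q : nat -> R) (mu : R) (b : nat).
Variable p : nat -> R.
Hypothesis hpar : cox_batch_params k lam q mu b p.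
Let rate := cox_rate (k := k) lam q mu b p.
Let o : 'I_k := Ordinal hk.
Let phi := phiY b p.
Let EC := mean_interarrival k lam q.
Let EY := mean_batch b p.
Let lam_gt0 := cox_lam_gt0 hpar.
Let q_bounds := cox_q_bounds hpar.
Let mu_gt0 := cox_mu_gt0 hpar.
Let p_ge0 := cox_p_ge0 hpar.
Let p_sum := cox_p_sum hpar.

Lemma cox_stationary g : 0 < g < 1 -> g = coxF k lam q mu b p g ->
  stationary_distribution rate
    (fun x => cox_level lam q mu b p g (cox_pi0 k lam q mu b p g) x.1 x.2).
Proof.
move=> g01 gF; set c := cox_pi0 _ _ _ _ _ _ _.
have n0 := cox_normal_gt0 hk hpar g01.
have c0 : 0 <= c by rewrite ltW// invr_gt0.
have a0 m (i : 'I_k) : 0 <= cox_level lam q mu b p g c m i.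
  exact: (cox_level_ge0 hk hpar).
split.
- by move=> [m i]; exact: a0.
- rewrite (cox_level_sum hk hpar g01 c0); congr (_%:E).
  by rewrite mulVf// gt_eqF.
- move=> [m i]; rewrite (cox_exit_rateE hk hpar) (cox_level_balance hk hpar g01 gF).
  rewrite esum_setC1 -(cox_inflow hk hpar)//.
  apply: eq_esum => x _; case: eqP => // ->.
  by rewrite cox_rate_diag mulr0.
Qed.

Lemma mean_batch_ge1 : 1 <= EY.
Proof.
rewrite /EY /mean_batch -[leLHS]p_sum; apply: ler_sum_nat => j /[dup] jb /p_ge0 pj.
by apply: ler_peMl => //; rewrite ler1n; case/andP: jb.
Qed.

Lemma mean_interarrival_gt0 : 0 < EC.
Proof.
rewrite /EC /mean_interarrival big_ltn// big_geq// mulr1 ltr_pwDl ?invr_gt0 ?lam_gt0//.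
rewrite big_nat_cond sumr_ge0// => i /andP[/andP[_ ik] _].
rewrite mulr_ge0 ?invr_ge0 ?(ltW (lam_gt0 _))// big_nat_cond prodr_ge0// => j.
by move=> /andP[/andP[_ ji] _]; case/andP: (q_bounds (ltn_trans ji ik)).
Qed.

(** Since [phi 1 = 1], the denominators reduce to [lam l] and the ratios telescope; the total of
    these weights is then [lam 0 * EC]. *)
Lemma phase_weight_1 i : (i < k)%N ->
  phase_weight lam q mu b p 1 i = lam 0%N / lam i * \prod_(0 <= l < i) q l.
Proof.
have phi1 : phi 1 = 1.
  by rewrite /phi /phiY -[RHS]p_sum; apply: eq_bigr => j _; rewrite expr1n mulr1.
elim: i => [|i IH] ik.
  by rewrite phase_weight0 big_geq// mulr1 divff// gt_eqF// lam_gt0.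
have li : lam i.+1 != 0 by rewrite gt_eqF// lam_gt0.
have li' : lam i != 0 by rewrite gt_eqF// lam_gt0// ltnW.
have := phase_weightS hpar (x := 1) _ ik; rewrite -/phi phi1 subrr mulr0 addr0.
rewrite ler01 lexx => /(_ isT); rewrite IH ?(ltnW ik)// => e.
apply: (mulIf li); rewrite e big_nat_recr//=.
by field; rewrite li li'.
Qed.

(** The polynomial [(1 - phi x) / (1 - x)], whose value at 1 is [EY]. *)
Let quot x := \sum_(1 <= j < b.+1) p j * \sum_(i < j) x ^+ i.
Let quotE x : (1 - x) * quot x = 1 - phi x.
Proof.
rewrite /quot mulr_sumr (_ : 1 - phi x = \sum_(1 <= j < b.+1) p j * (1 - x ^+ j)).
  apply: eq_bigr => j _; rewrite -[1 - x ^+ j]opprB subrX1; ring.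
rewrite /phi /phiY -[X in X - _ = _]p_sum -sumrB; apply: eq_bigr => j _; ring.
Qed.

Lemma continuous_at_sum (I : Type) (r : seq I) (F : I -> R -> R) x :
  (forall i, {for x, continuous (F i)}) ->
  {for x, continuous (fun y => \sum_(i <- r) F i y)}.
Proof.
move=> Fc; elim: r => [|i r IH].
  rewrite (_ : (fun _ => _) = cst 0); first exact: cst_continuous.
  by apply/funext => y; rewrite big_nil.
rewrite (_ : (fun _ => _) = F i + (fun y => \sum_(j <- r) F j y)).
  exact: (continuousD (Fc i) IH).
by apply/funext => y; rewrite big_cons.
Qed.

Lemma continuous_phiY x : {for x, continuous (phi : R -> R)}.
Proof.
apply: continuous_at_sum => j; apply: continuousM; first exact: cst_continuous.
exact: exprn_continuous.
Qed.

Lemma continuous_phase_weight i x : 0 <= x <= 1 -> (i < k)%N ->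
  {for x, continuous (phase_weight lam q mu b p ^~ i)}.
Proof.
move=> x01; elim: i => [|i IH] ik.
  rewrite (_ : _ ^~ _ = cst 1); first exact: cst_continuous.
  by apply/funext => y; rewrite phase_weight0.
rewrite (_ : _ ^~ _ = (phase_weight lam q mu b p ^~ i) \*
    (fun y => q i * (lam i * (lam i.+1 + mu - mu * phi y)^-1))); last first.
  by apply/funext => y; rewrite /phase_weight big_nat_recr.
apply: continuousM; first by apply: IH; exact: ltnW.
apply: continuousM; first exact: cst_continuous.
apply: continuousM; first exact: cst_continuous.
apply: continuousV.
  rewrite gt_eqF// -addrA ltr_pwDl ?lam_gt0// -{1}[mu]mulr1 -mulrBr.
  rewrite mulr_ge0 ?(ltW mu_gt0)// subr_ge0 (le_trans (phiY_le hpar x01))//.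
  by case/andP: x01.
apply: continuousB; first exact: cst_continuous.
by apply: continuousM; [exact: cst_continuous|exact: continuous_phiY].
Qed.

(** The function [h] is minus the arrival sum at 0 and [lam 0 * (mu * EY * EC - 1)] at 1, so the
    drift condition is exactly positivity at 1. *)
Lemma cox_root : 1 / EC < mu * EY ->
  exists g, 0 < g < 1 /\ g = coxF k lam q mu b p g.
Proof.
move=> drift.
pose h x := mu * quot x * (\sum_(0 <= i < k) phase_weight lam q mu b p x i)
  - (lam 0%N + mu * (1 - phi x)).
have hE x : 0 <= x < 1 -> h x = 0 -> x = coxF k lam q mu b p x.
  move=> /andP[x0 x1] hx; apply/(coxF_fixpoint hk hpar); first by rewrite x0 ltW.
  rewrite -/phi -{1}quotE; move/eqP: hx; rewrite subr_eq0 => /eqP <-.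
  by ring.
have h0 : h 0 < 0.
  have x01 : 0 <= (0 : R) <= 1 by rewrite lexx ler01.
  have phi0 : phi 0 = 0.
    by rewrite /phi /phiY big_nat_cond big1// => -[|j]// _; rewrite expr0n mulr0.
  have q0 : quot 0 = 1 by have := quotE 0; rewrite phi0 !subr0 mul1r.
  have := sum_phase_weight hk hpar x01; rewrite -/phi phi0 subr0 mulr1 => e.
  rewrite /h q0 mulr1 phi0 subr0 mulr1 e.
  set S := \sum_(_ <= _ < _) _; suff : 0 < S by move=> S0; lra.
  have nn i : (i < k)%N -> 0 <= phase_weight lam q mu b p 0 i * (1 - q i) * lam i.
    move=> ik; rewrite !mulr_ge0 ?(phase_weight_ge0 hpar)// ?subr_ge0.
      by case/andP: (q_bounds ik).
    by rewrite ltW// lam_gt0.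
  (* Only the last term is surely positive: there [1 - q] equals 1. *)
  rewrite /S -(prednK hk) big_nat_recr//= ltr_wpDl//.
    rewrite big_nat_cond sumr_ge0// => i /andP[/andP[_ ik] _]; apply: nn.
    by rewrite (leq_trans ik)// leq_pred.
  have ql : q k.-1 = 0 by case: hpar.
  rewrite ql subr0 mulr1 mulr_gt0 ?lam_gt0 ?prednK//.
  by apply: (phase_weight_gt0 hpar); rewrite ?prednK.
have h1 : 0 < h 1.
  have phi1 : phi 1 = 1.
    by rewrite /phi /phiY -[RHS]p_sum; apply: eq_bigr => j _; rewrite expr1n mulr1.
  have q1 : quot 1 = EY.
    rewrite /quot /EY /mean_batch; apply: eq_bigr => j _.
    by rewrite (eq_bigr (fun=> 1)) ?sumr_const ?card_ord 1?mulrC// => i _; rewrite expr1n.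
  rewrite /h (_ : \sum_(0 <= i < k) phase_weight lam q mu b p 1 i = lam 0%N * EC); last first.
    rewrite /EC /mean_interarrival mulr_sumr; apply: eq_big_nat => i /andP[_ ik].
    by rewrite phase_weight_1// mulrA.
  rewrite q1 phi1 subrr mulr0 addr0 subr_gt0 mulrCA ltr_pMr ?lam_gt0//.
  by rewrite -ltr_pdivrMr// mean_interarrival_gt0.
have hcx x : 0 <= x <= 1 -> {for x, continuous h}.
  move=> x01; apply: (@continuousB _ _ _
    (fun y => mu * quot y * \sum_(0 <= i < k) phase_weight lam q mu b p y i)
    (fun y => lam 0%N + mu * (1 - phi y))).
    apply: continuousM.
      apply: continuousM; first exact: cst_continuous.
      apply: continuous_at_sum => j; apply: continuousM; first exact: cst_continuous.
      by apply: continuous_at_sum => i; exact: exprn_continuous.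
    rewrite (_ : (fun _ => _) = fun y => \sum_(i < k) phase_weight lam q mu b p y i).
      by apply: continuous_at_sum => i; exact: continuous_phase_weight.
    by apply/funext => y; rewrite big_mkord.
  apply: continuousD; first exact: cst_continuous.
  apply: continuousM; first exact: cst_continuous.
  by apply: continuousB; [exact: cst_continuous|exact: continuous_phiY].
have hc : {within `[0, 1], continuous h}.
  by apply: continuous_in_subspaceT => x; rewrite inE/= in_itv/=; exact: hcx.
have [|x] := IVT (v := 0) ler01 hc.
  by rewrite min_l ?max_r ?(ltW h0) ?(ltW h1)// (le_trans (ltW h0))// ltW.
rewrite in_itv/= => /andP[x0 x1] hx.
have xn0 : x != 0 by apply/eqP => e; move: h0; rewrite -[X in h X]e hx ltxx.
have xn1 : x != 1 by apply/eqP => e; move: h1; rewrite -[X in h X]e hx ltxx.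
have x01 : 0 < x < 1 by rewrite !lt_neqAle x0 x1 eq_sym xn0 xn1.
by exists x; split => //; apply: hE => //; rewrite x0; case/andP: x01.
Qed.

End CoxErgodicity.
(** * Necessity of the drift condition *)

Section CoxDrift.
Context {R : realType}.
Variables (k : nat) (hk : (0 < k)%N) (lam q : nat -> R) (mu : R) (b : nat).
Variable p : nat -> R.
Hypothesis hpar : cox_batch_params k lam q mu b p.
Let rate := cox_rate (k := k) lam q mu b p.
Let o : 'I_k := Ordinal hk.
Let EC := mean_interarrival k lam q.
Let EY := mean_batch b p.
Let lam_gt0 := cox_lam_gt0 hpar.
Let q_bounds := cox_q_bounds hpar.
Let mu_gt0 := cox_mu_gt0 hpar.
Let p_ge0 := cox_p_ge0 hpar.
Let p_sum := cox_p_sum hpar.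
Let EC_gt0 : 0 < EC := mean_interarrival_gt0 hk hpar.

(* Mean time to the next arrival from phase [i]. *)
Definition residual i : R := \sum_(i <= j < k) (lam j)^-1 * \prod_(i <= l < j) q l.

Lemma residualE i : (i < k)%N -> lam i * (residual i - q i * residual i.+1) = 1.
Proof.
move=> ik; have li : lam i != 0 by rewrite gt_eqF// lam_gt0.
rewrite /residual big_ltn// [\prod_(i <= l < i) _]big_geq// mulr1.
have -> : \sum_(i.+1 <= j < k) (lam j)^-1 * \prod_(i <= l < j) q l =
    q i * \sum_(i.+1 <= j < k) (lam j)^-1 * \prod_(i.+1 <= l < j) q l.
  rewrite mulr_sumr; apply: eq_big_nat => j /andP[ij _].
  by rewrite [in LHS]big_ltn// mulrCA.
by rewrite addrK divff.
Qed.

Lemma residual_ge0 i : 0 <= residual i.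
Proof.
rewrite /residual big_nat_cond sumr_ge0// => j /andP[/andP[_ jk] _].
rewrite mulr_ge0 ?invr_ge0 ?(ltW (lam_gt0 _))// big_nat_cond prodr_ge0// => l.
by move=> /andP[/andP[_ lj] _]; case/andP: (q_bounds (ltn_trans lj jk)).
Qed.

Let th := EC^-1.
(** A constant above every residual time, added to make [f] nonnegative; it does not change the
    drift. *)
Let K := \sum_(i < k) residual i.

(* Truncating the level at [M] keeps the function bounded; the phase correction
   makes its drift constant up to the services. *)
Let f M (x : nat * 'I_k) : R := (minn x.1 M)%:R + th * (K - residual x.2).

Let th_gt0 : 0 < th. Proof. by rewrite invr_gt0. Qed.

Let residual_le (i : 'I_k) : residual i <= K.
Proof. by rewrite /K (bigD1 i)//= lerDl sumr_ge0// => j _; exact: residual_ge0. Qed.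

Let f_ge0 M x : 0 <= f M x.
Proof. by rewrite addr_ge0// mulr_ge0 ?(ltW th_gt0)// subr_ge0. Qed.

Let f_le M x : f M x <= M%:R + th * K.
Proof.
apply: lerD; first by rewrite ler_nat geq_minr.
by rewrite ler_pM2l// gerBl residual_ge0.
Qed.

Let gen M (x : nat * 'I_k) : R := q x.2 * lam x.2 * f M (x.1, next_phase x.2)
  + (1 - q x.2) * lam x.2 * f M (x.1.+1, o)
  + (0 < x.1)%N%:R * mu * \sum_(1 <= j < b.+1) p j * f M ((x.1 - j)%N, x.2).

Let L := \sum_(i < k) lam i.

(** By [residualE], phase changes and arrivals together contribute [th] from every phase. Truncation
    loses at most the arrival rate, bounded by [L], on levels from [M] on; a batch of size [j]
    lowers the truncated level by at most [j]. *)
Let gen_ge M x : exit_rate rate x * f M x + th <=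
  gen M x + L * (M <= x.1)%N%:R + mu * EY * (0 < x.1)%N%:R.
Proof.
case: x => m i; rewrite (cox_exit_rateE hk hpar) /gen /=.
have ik := ltn_ord i; have /andP[q0 q1] := q_bounds ik; have li := lam_gt0 ik.
have lL : lam i <= L.
  by rewrite /L (bigD1 i)//= lerDl sumr_ge0// => j _; rewrite ltW// lam_gt0.
have res := residualE ik.
have qnext : q i * residual (next_phase i) = q i * residual i.+1.
  have [ik'|ki] := ltnP i.+1 k; first by rewrite val_next_phase.
  have -> : q i = 0; last by rewrite !mul0r.
  by case: hpar => _ _ ql _ _; rewrite -ql; congr q; move: ik ki; lia.
have res0 : residual o = EC by [].
have thEC : th * EC = 1 by rewrite /th mulVf// gt_eqF.
have services : (minn m M)%:R - EY <= \sum_(1 <= j < b.+1) p j * (minn (m - j) M)%:R.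
  have -> : (minn m M)%:R = \sum_(1 <= j < b.+1) p j * (minn m M)%:R :> R.
    by rewrite -mulr_suml p_sum mul1r.
  rewrite /EY /mean_batch -sumrB.
  apply: ler_sum_nat => j /p_ge0 pj; rewrite [j%:R * _]mulrC -mulrBr ler_wpM2l//.
  by rewrite lerBlDr -natrD ler_nat; lia.
have -> : \sum_(1 <= j < b.+1) p j * f M ((m - j)%N, i) =
    \sum_(1 <= j < b.+1) p j * (minn (m - j) M)%:R + th * (K - residual i).
  rewrite -[X in _ = _ + X]mul1r -[X in _ = _ + X * _]p_sum mulr_suml -big_split/=.
  by apply: eq_bigr => j _; rewrite /f mulrDr.
move: services; set D := \sum_(_ <= _ < _) _ => services.
have arrival : (minn m.+1 M)%:R = (minn m M)%:R + 1 - (M <= m)%N%:R :> R.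
  case: (boolP (M <= m)%N) => mM.
    by rewrite (_ : minn m.+1 M = minn m M) ?addrK//; lia.
  by rewrite (_ : minn m.+1 M = (minn m M).+1) ?subr0 ?natr1//; lia.
rewrite /f /= res0 arrival.
set e := (M <= m)%N%:R; set y := (minn m M)%:R; set n := (0 < m)%N%:R.
have e0 : 0 <= e by exact: ler0n.
have n0 : 0 <= n by exact: ler0n.
have h1 : (1 - q i) * lam i * e <= L * e.
  rewrite ler_wpM2r// (le_trans _ lL)// -[leRHS]mul1r ler_wpM2r ?(ltW li)//.
  by rewrite gerBl.
have h2 : n * mu * (y - EY) <= n * mu * D by rewrite ler_wpM2l// mulr_ge0// ltW.
have e1 : lam i * (q i * (th * residual (next_phase i))) = lam i * th * (residual i) - th.
  have -> : lam i * (q i * (th * residual (next_phase i))) =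
     lam i * th * (q i * residual (next_phase i)) by ring.
  rewrite qnext -[X in _ - X]mulr1 -res; ring.
have e2 : (1 - q i) * lam i * (th * EC) = (1 - q i) * lam i by rewrite thEC mulr1.
have -> : q i * lam i * (y + th * (K - residual (next_phase i))) =
  q i * lam i * (y + th * K) - (lam i * th * residual i - th) by rewrite -e1; ring.
have -> : (1 - q i) * lam i * (y + 1 - e + th * (K - EC)) =
  (1 - q i) * lam i * (y - e + th * K) by rewrite -{2}thEC; ring.
have : 0 <= n * mu * (D - (y - EY)) by rewrite mulr_ge0 ?subr_ge0// mulr_ge0// ltW.
have : 0 <= L * e - (1 - q i) * lam i * e by rewrite subr_ge0.
move=> h3 h4; rewrite -subr_ge0; apply: le_trans (addr_ge0 h3 h4) _.
by rewrite le_eqVlt; apply/orP; left; apply/eqP; ring.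
Qed.

Variable pi : nat * 'I_k -> R.
Hypothesis pis : stationary_distribution rate pi.

Let pi0 x : 0 <= pi x. Proof. by case: pis. Qed.
Let pi1 : esum setT (fun x => (pi x)%:E) = 1%E. Proof. by case: pis. Qed.

Let rate_ge0 x y : 0 <= rate x y. Proof. exact: (cox_rate_ge0 hk hpar). Qed.

Let exit_ge0 x : 0 <= exit_rate rate x.
Proof.
have /andP[h _] := cox_exit_bounds hk hpar x.
by apply: le_trans h; exact/ltW/(cox_exit_lo_gt0 hk hpar).
Qed.

Let gen_ge0 M x : 0 <= gen M x.
Proof.
have /andP[q0 q1] := q_bounds (ltn_ord x.2).
have l0 := ltW (lam_gt0 (ltn_ord x.2)).
rewrite !addr_ge0 ?mulr_ge0 ?f_ge0 ?subr_ge0 ?(ltW mu_gt0)//.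
by rewrite big_nat_cond sumr_ge0// => j /andP[/p_ge0 pj _]; rewrite mulr_ge0.
Qed.

(** Stationarity makes the mean drift of [f M] vanish; exchanging the sums reduces this to the
    balance equation at each [y]. *)
Let esum_gen M : esum setT (fun x => (pi x * gen M x)%:E) =
  esum setT (fun x => (pi x * exit_rate rate x * f M x)%:E).
Proof.
transitivity (esum setT (fun x => esum setT (fun y => (pi x * rate x y * f M y)%:E))).
  apply: eq_esum => -[m i] _; rewrite EFinM.
  rewrite /gen -(cox_generator hk hpar) -?esumZl//.
  - by apply: eq_esum => y _; rewrite -EFinM mulrA.
  - by rewrite lee_fin.
  - by move=> y; rewrite lee_fin mulr_ge0.
rewrite esum_exchange; last by move=> x y; rewrite lee_fin !mulr_ge0.
apply: eq_esum => y _; under eq_esum do rewrite EFinM.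
rewrite esumZr; [|by rewrite lee_fin|by move=> x; rewrite lee_fin mulr_ge0].
rewrite EFinM; congr (_ * _)%E; have [_ _ ->] := pis; rewrite esum_setC1.
by apply: eq_esum => x _; case: eqP => // ->; rewrite /rate cox_rate_diag mulr0.
Qed.

Let mass (Q : pred (nat * 'I_k)) := esum setT (fun x => (pi x * (Q x)%:R)%:E).

Let mass_ge0 Q : (0 <= mass Q)%E.
Proof. by apply: esum_ge0 => x _; rewrite lee_fin mulr_ge0. Qed.

Let mass_le1 Q : (mass Q <= 1)%E.
Proof.
rewrite -pi1; apply: le_esum => x _; rewrite lee_fin.
by case: (Q x); rewrite ?mulr1 ?mulr0.
Qed.

Let mass_fin Q : mass Q \is a fin_num.
Proof. by rewrite ge0_fin_numE//; apply: le_lt_trans (mass_le1 Q) _; rewrite ltry. Qed.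

Let mass_disj Q Q' : (forall x, ~~ (Q x && Q' x)) -> (mass Q + mass Q' <= 1)%E.
Proof.
move=> QQ'; rewrite -esumD; last 2 first.
- by move=> x _; rewrite lee_fin mulr_ge0.
- by move=> x _; rewrite lee_fin mulr_ge0.
rewrite -pi1; apply: le_esum => x _; rewrite -EFinD lee_fin.
by move: (QQ' x); case: (Q x); case: (Q' x) => // _; rewrite ?mulr1 ?mulr0 ?addr0 ?add0r.
Qed.

Let esum_lin (a c : nat * 'I_k -> R) (l : R) :
  (forall x, 0 <= a x) -> (forall x, 0 <= c x) -> 0 <= l ->
  (esum setT (fun x => (a x)%:E) + l%:E * esum setT (fun x => (c x)%:E))%E =
  esum setT (fun x => (a x + l * c x)%:E).
Proof.
move=> a0 c0 l0; rewrite -esumZl ?lee_fin// -esumD//; last first.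
  by move=> x _; rewrite mule_ge0 ?lee_fin.
by move=> x _; rewrite lee_fin.
Qed.

Let mass_bound M :
  th <= L * fine (mass (fun x => M <= x.1)%N) + mu * EY * fine (mass (fun x => 0 < x.1)%N).
Proof.
have EY0 : 0 <= EY by apply: le_trans (mean_batch_ge1 hpar); exact: ler01.
have L0 : 0 <= L by apply: sumr_ge0 => i _; rewrite ltW// lam_gt0.
have muEY : 0 <= mu * EY by rewrite mulr_ge0// ltW.
pose S := esum setT (fun x => (pi x * exit_rate rate x * f M x)%:E).
have S0 : (0 <= S)%E by apply: esum_ge0 => x _; rewrite lee_fin !mulr_ge0.
have Sfin : S \is a fin_num.
  rewrite ge0_fin_numE//; apply: (@le_lt_trans _ _
      (esum setT (fun x => (cox_exit_hi k lam mu * (M%:R + th * K))%:E * (pi x)%:E)%E)).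
    apply: le_esum => x _; rewrite -EFinM lee_fin -mulrA mulrC ler_wpM2r//.
    by apply: ler_pM => //; case/andP: (cox_exit_bounds hk hpar x).
  rewrite esumZl ?pi1 ?mule1 ?ltry//.
  rewrite lee_fin mulr_ge0//; last by apply: le_trans (f_le M (0%N, o)).
  by apply: le_trans (exit_ge0 (0%N, o)) _; case/andP: (cox_exit_bounds hk hpar (0%N, o)).
have : (S + th%:E <= S + (L%:E * mass (fun x => M <= x.1)%N
    + (mu * EY)%:E * mass (fun x => 0 < x.1)%N))%E.
  rewrite -[X in (_ + X <= _)%E]mule1 -pi1 esum_lin ?(ltW th_gt0)//; last first.
    by move=> x; rewrite !mulr_ge0.
  rewrite {1}/S -esum_gen addeA esum_lin//; last 2 first.
  - by move=> x; rewrite mulr_ge0.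
  - by move=> x; rewrite mulr_ge0.
  rewrite esum_lin//; last 2 first.
  - by move=> x; rewrite addr_ge0 ?mulr_ge0.
  - by move=> x; rewrite mulr_ge0.
  apply: le_esum => x _; rewrite lee_fin.
  have := ler_wpM2l (pi0 x) (gen_ge M x); rewrite !mulrDr => h.
  apply: le_trans (le_trans _ h) _; rewrite le_eqVlt; apply/orP; left; apply/eqP; ring.
rewrite leeD2lE// -(fineK (mass_fin (fun x => M <= x.1)%N)).
by rewrite -(fineK (mass_fin (fun x => 0 < x.1)%N)) -!EFinM -EFinD lee_fin.
Qed.

(** A finite set of states carries all but [e] of the mass, and [M] exceeds every level in it. *)
Let mass_tail e : 0 < e -> exists M, fine (mass (fun x => M <= x.1)%N) < e.
Proof.
have supfin : esum setT (fun x => (pi x)%:E) \is a fin_num by rewrite pi1.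
move=> e0; have [_ [X [finX _] <-] lt'] := ub_ereal_sup_adherent e0 supfin.
have lt : (1 - e%:E < \sum_(x \in X) (pi x)%:E)%E by rewrite -pi1; exact: lt'.
have [l Xl] := (finite_seqP X).1 finX; pose M := (\max_(x <- l) x.1).+1; exists M.
have XM x : X x -> (x.1 < M)%N.
  by rewrite Xl => xl; rewrite ltnS (@leq_bigmax_seq _ _ xpredT (fun x => x.1)).
have := @mass_disj (fun x => M <= x.1)%N (fun x => x \in X).
have -> : mass (fun x => x \in X) = (\sum_(x \in X) (pi x)%:E)%E.
  rewrite -esum_fset//; last by move=> x _; rewrite lee_fin.
  rewrite [RHS]esum_mkcond; apply: eq_esum => x _.
  by case: (x \in X); rewrite ?mulr1 ?mulr0.
have Xfin : (\sum_(x \in X) (pi x)%:E)%E \is a fin_num.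
  rewrite ge0_fin_numE; last by apply: fsume_ge0 => x _; rewrite lee_fin.
  rewrite -esum_fset//; last by move=> x _; rewrite lee_fin.
  apply: (@le_lt_trans _ _ 1%E); last exact: ltry.
  rewrite -pi1 esum_mkcond; apply: le_esum => x _.
  by case: ifP => // _; rewrite lee_fin.
have h1 : 1 - e < fine (\sum_(x \in X) (pi x)%:E)%E.
  by rewrite -lte_fin fineK// EFinB.
rewrite -(fineK Xfin) -(fineK (mass_fin (fun x => M <= x.1)%N)) -EFinD.
rewrite lee_fin => h2.
suff /h2 : forall x, ~~ ((M <= x.1)%N && (x \in X)) by move=> ?; lra.
move=> x; apply/negP => /andP[Mx]; rewrite inE => /XM.
by rewrite ltnNge Mx.
Qed.

Lemma cox_drift : 1 / EC < mu * EY.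
Proof.
rewrite div1r -/th.
have EY0 : 0 < EY by apply: lt_le_trans (mean_batch_ge1 hpar); exact: ltr01.
have L0 : 0 < L.
  by rewrite /L (bigD1 o)//= ltr_pwDl ?lam_gt0// sumr_ge0// => i _; rewrite ltW// lam_gt0.
have po : 0 < pi (0%N, o).
  exact: (stationary_gt0 rate_ge0 (cox_exit_lo_gt0 hk hpar)
    (cox_exit_bounds hk hpar) (cox_connected hk hpar) _ pis).
have busy : fine (mass (fun x => 0 < x.1)%N) <= 1 - pi (0%N, o).
  have := @mass_disj (fun x => 0 < x.1)%N (pred1 (0%N, o)) _.
  have -> : mass (pred1 (0%N, o)) = (pi (0%N, o))%:E.
    rewrite /mass (@esum_delta _ _ (0%N, o)) ?eqxx ?mulr1 ?lee_fin//.
    by move=> y /= /negbTE ->; rewrite mulr0.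
  rewrite -(fineK (mass_fin (fun x => 0 < x.1)%N)) -EFinD lee_fin => h.
  by rewrite lerBrDr; apply: h => -[m i]/=; rewrite xpair_eqE; case: m.
(* With tail mass below this number, the truncation loss is smaller than what the idle state
   [(0, o)] saves in services; this gives strictness. *)
have d0 : 0 < mu * EY * pi (0%N, o) / L by rewrite divr_gt0// !mulr_gt0.
have [M hM] := mass_tail d0.
apply: le_lt_trans (mass_bound M) _.
have h1 : L * fine (mass (fun x => M <= x.1)%N) < mu * EY * pi (0%N, o).
  by rewrite mulrC -ltr_pdivlMr.
have h2 : mu * EY * fine (mass (fun x => 0 < x.1)%N) <= mu * EY * (1 - pi (0%N, o)).
  by rewrite ler_pM2l// mulr_gt0.
apply: lt_le_trans (ltr_leD h1 h2) _.
by rewrite le_eqVlt; apply/orP; left; apply/eqP; ring.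
Qed.

End CoxDrift.
(** * Mean inter-arrival time and batch size *)

Section ModelMeans.
Context {R : realType} {d : measure_display} {T : measurableType d}.
Variable P : probability T R.

(** Lower bounds on point probabilities that already add up to 1 must be equalities; in particular
    no mass is left outside the prescribed values. *)
Lemma discrete_law (N : T -> nat) (a : nat -> R) (m : nat) :
  (forall n, measurable (N @^-1` [set n])) -> (forall n, 0 <= a n) ->
  (forall n, (m <= n)%N -> a n = 0) ->
  (forall n, (n < m)%N -> ((a n)%:E <= P (N @^-1` [set n]))%E) ->
  \sum_(0 <= n < m) a n = 1 -> forall n, P (N @^-1` [set n]) = (a n)%:E.
Proof.
move=> mN a0 am aP a1 n; apply/esym.
have tot : esum setT (fun n => P (N @^-1` [set n])) = 1%E.
  rewrite -(probability_setT P) -(measure_bigcup_countable _ mN); last first.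
    by apply/trivIsetP => i j _ _ ij; rewrite -subset0 => w [/= -> e]; rewrite e eqxx in ij.
  congr (P _); apply/seteqP; split => w // _; by exists (N w).
apply: (@eq_of_esum R _ (fun n => (a n)%:E) (fun n => P (N @^-1` [set n]))) => //.
- by move=> i; case: (ltnP i m) => [/aP//|/am ->]; exact: measure_ge0.
- by rewrite tot ltry.
- rewrite tot (@esum_fin_support _ _ (index_iota 0 m)) ?iota_uniq//.
    by rewrite sumEFin a1.
  by move=> i; rewrite mem_index_iota/= -leqNgt => /am ->.
Qed.

Lemma batch_size_mean (b : nat) (p : nat -> R) (Y : T -> nat) :
  (forall j, (1 <= j <= b)%N -> 0 <= p j) -> \sum_(1 <= j < b.+1) p j = 1 ->
  batch_size b p P Y -> ('E_P[fun w => (Y w)%:R] = (mean_batch b p)%:E)%E.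
Proof.
move=> p0 p1 [mY lawY].
pose a j := if (1 <= j <= b)%N then p j else 0.
have aY j : P (Y @^-1` [set j]) = (a j)%:E.
  apply: (@discrete_law Y a b.+1) => //.
  - by move=> n; rewrite /a; case: ifP => // /p0.
  - by move=> n bn; rewrite /a ifF//; lia.
  - by move=> n _; rewrite /a; case: ifP => [/lawY ->//|_]; exact: measure_ge0.
  - rewrite big_ltn// {1}/a/= add0r -p1; apply: eq_big_nat => l lb.
    by rewrite /a -ltnS lb.
rewrite unlock.
transitivity (\int[P]_w esum setT (fun j : nat => (j%:R * \1_(Y @^-1` [set j]) w)%:E))%E.
  apply: eq_integral => w _; rewrite (@esum_delta _ _ (Y w)).
  - by rewrite indicE mem_set// mulr1.
  - by rewrite lee_fin mulr_ge0.
  - by move=> j jY; rewrite indicE memNset ?mulr0// => /= e; rewrite e eqxx in jY.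
rewrite integral_esum; last 2 first.
- move=> j; apply/measurable_EFinP; apply: measurable_realfun.measurable_funM.
    exact: measurable_cst.
  exact: measurable_indic.
- by move=> j w; rewrite lee_fin mulr_ge0.
transitivity (esum setT (fun j => (j%:R * a j)%:E)).
  apply: eq_esum => j _; under eq_integral do rewrite EFinM.
  rewrite ge0_integralZl//.
  - by rewrite integral_indic// setIT; move: (aY j) => /= ->; rewrite -EFinM.
  - by apply/measurable_EFinP; exact: measurable_indic.
rewrite (@esum_fin_support _ _ (index_iota 1 b.+1)) ?iota_uniq//; last 2 first.
- by move=> j; rewrite lee_fin /a; case: ifP => [/p0 pj|_]; rewrite mulr_ge0.
- by move=> j; rewrite mem_index_iota ltnS /a => /negbTE ->; rewrite mulr0.
rewrite sumEFin; congr (_%:E); apply: eq_big_nat => j jb.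
by rewrite /a -ltnS jb.
Qed.

Variables (k : nat) (lam q : nat -> R).
Hypothesis k_gt0 : (0 < k)%N.
Hypothesis lam_gt0 : forall i, (i < k)%N -> 0 < lam i.
Hypothesis q_bounds : forall i, (i < k)%N -> 0 <= q i <= 1.
Hypothesis q_last : q k.-1 = 0.

(** [Q n] is the probability of reaching phase [n], and [a n], below, that of ending there. *)
Let Q n := \prod_(i < n) q i.
Let a n := if (n < k)%N then Q n * (1 - q n) else 0.

Let Qk : Q k = 0.
Proof. by rewrite /Q -(prednK k_gt0) big_ord_recr/= q_last mulr0. Qed.

Let Q_ge0 n : (n <= k)%N -> 0 <= Q n.
Proof.
move=> nk; apply: prodr_ge0 => i _.
by case/andP: (q_bounds (leq_trans (ltn_ord i) nk)).
Qed.

Let a_ge0 n : 0 <= a n.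
Proof.
rewrite /a; case: ifP => // nk; rewrite mulr_ge0 ?Q_ge0 1?ltnW//.
by rewrite subr_ge0; case/andP: (q_bounds nk).
Qed.

Let sum_a : \sum_(0 <= n < k) a n = 1.
Proof.
have main m : (m <= k)%N -> \sum_(0 <= n < m) a n = 1 - Q m.
  elim: m => [|m IH] mk; first by rewrite big_geq// /Q big_ord0 subrr.
  by rewrite big_nat_recr//= IH ?(ltnW mk)// /a mk /Q big_ord_recr/=; ring.
by rewrite main// Qk subr0.
Qed.

(** Summation by parts with [a n = Q n - Q n.+1]; the end term disappears because [Q k = 0]. *)
Let sum_a_inv : \sum_(0 <= n < k) (\sum_(i < n.+1) (lam i)^-1) * a n =
  mean_interarrival k lam q.
Proof.
have main m : (m <= k)%N -> \sum_(0 <= n < m) (\sum_(i < n.+1) (lam i)^-1) * a n +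
    Q m * \sum_(i < m) (lam i)^-1 = \sum_(0 <= i < m) (lam i)^-1 * \prod_(0 <= l < i) q l.
  elim: m => [|m IH] mk; first by rewrite !big_geq// big_ord0 mulr0 addr0.
  rewrite !(@big_nat_recr _ _ _ m 0)//= -IH ?(ltnW mk)// /a mk.
  by rewrite big_ord_recr/= /Q big_ord_recr/= [\prod_(0 <= l < m) _]big_mkord; ring.
by have := main k (leqnn k); rewrite Qk mul0r addr0.
Qed.

Lemma coxian_mean (C : T -> R) : coxian k lam q P C ->
  ('E_P[C] = (mean_interarrival k lam q)%:E)%E.
Proof.
move=> [N [V [mN mV V0 law CE]]].
pose ev n (t : nat -> R) := [set w | N w = n /\ forall i, (i <= n)%N -> t i < V i w].
have mVt i t : measurable [set w | (t < V i w)%R].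
  rewrite -[X in measurable X]setTI -preimage_true.
  by apply: measurable_fun_ltr.
have mev n t : measurable (ev n t).
  rewrite (_ : ev n t = N @^-1` [set n] `&`
      \bigcap_i (if (i <= n)%N then [set w | t i < V i w] else setT)).
    by apply: measurableI => //; apply: bigcapT_measurable => i; case: ifP.
  apply/seteqP; split => w [Nn h]; split => // i; first by move=> _; case: ifP => // /h.
  by move=> im; have := h i Logic.I; rewrite im.
have lawE n t : (n < k)%N -> (forall i, 0 <= t i) ->
    P (ev n t) = (a n * \prod_(i < n.+1) expR (- (lam i * t i)))%:E.
  by move=> nk t0; rewrite law// /a nk.
have law0 n : (n < k)%N -> P (ev n (fun=> 0)) = (a n)%:E.
  by move=> nk; rewrite lawE// big1 ?mulr1// => i _; rewrite mulr0 oppr0 expR0.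
have aN n : P (N @^-1` [set n]) = (a n)%:E.
  apply: (@discrete_law N a k) => // m mk; first by rewrite /a ltnNge mk.
  by rewrite -law0//; apply: le_measure; rewrite ?inE// => w [].
have tail n i t : (n < k)%N -> (i <= n)%N -> 0 <= t ->
    P (N @^-1` [set n] `&` [set w | t < V i w]) = (a n * expR (- (lam i * t)))%:E.
  move=> nk im t0; pose z j := if j == i then t else 0.
  have z0 j : 0 <= z j by rewrite /z; case: ifP.
  have e1 : P (ev n z) = (a n * expR (- (lam i * t)))%:E.
    rewrite lawE// (bigD1 (Ordinal (im : (i < n.+1)%N)))//= /z eqxx.
    rewrite big1 ?mulr1// => j ji; rewrite ifF ?mulr0 ?oppr0 ?expR0//.
    by apply/negbTE; apply: contraNneq ji => e; apply/eqP/val_inj.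
  (* The lengths [V i] may vanish, so the event with all thresholds 0 can be smaller than [N = n],
     but only by a null set. *)
  have null : P (N @^-1` [set n] `\` ev n (fun=> 0)) = 0%E.
    rewrite measureD//=; last by rewrite -ge0_fin_numE// fin_num_measure.
    rewrite (setIidr _) ?aN ?law0 ?subee// => w; by case.
  rewrite -e1; apply/eqP; rewrite eq_le; apply/andP; split; last first.
    apply: le_measure; rewrite ?inE//; first exact: measurableI.
    move=> w [Nn h]; split => //=.
    by have := h i im; rewrite /z eqxx.
  apply: (@le_trans _ _ (P (ev n z `|` (N @^-1` [set n] `\` ev n (fun=> 0))))).
    apply: le_measure; rewrite ?inE//; first exact: measurableI.
      by apply: measurableU => //; exact: measurableD.
    move=> w [Nn tV]; have [h|h] := pselect (ev n (fun=> 0) w); last by right.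
    left; split => // j jn; rewrite /z; case: eqP => [->//|_].
    by case: h => _; exact.
  apply: le_trans (measureU2 _ _ _) _ => //; first exact: measurableD.
  by move: null => /= ->; rewrite adde0.
rewrite unlock.
pose g n w := (\sum_(i < n.+1) (V i w * \1_(N @^-1` [set n]) w)%:E)%E.
have VI0 n i w : (0 <= (V i w * \1_(N @^-1` [set n]) w)%:E)%E.
  by rewrite lee_fin mulr_ge0.
have mVI n i : measurable_fun setT (fun w => (V i w * \1_(N @^-1` [set n]) w)%:E).
  apply/measurable_EFinP; apply: measurable_realfun.measurable_funM; first exact: mV.
  exact: measurable_indic.
have g0 n w : (0 <= g n w)%E by apply: sume_ge0.
transitivity (\int[P]_w esum setT (g^~ w))%E.
  apply: eq_integral => w _; rewrite (@esum_delta _ _ (N w))//.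
    rewrite /g CE -sumEFin; apply: eq_bigr => i _.
    by rewrite indicE mem_set// mulr1.
  move=> n nN; apply: big1 => i _.
  by rewrite indicE memNset ?mulr0//= => e; rewrite e eqxx in nN.
rewrite integral_esum//; last by move=> n; exact: emeasurable_sum.
transitivity (esum setT (fun n => ((\sum_(i < n.+1) (lam i)^-1) * a n)%:E)).
  apply: eq_esum => n _; rewrite ge0_integral_sum// mulr_suml -sumEFin.
  apply: eq_bigr => i _; case: (ltnP n k) => nk; last first.
    have an0 : a n = 0 by rewrite /a ltnNge nk.
    (* The event [N = n] is null here, so any positive rate serves; 1 is taken. *)
    rewrite an0 mulr0 -[0](mul0r 1^-1); apply: integral_exponential_on => // t t0.
    rewrite mul0r; apply/eqP; rewrite eq_le measure_ge0 andbT -[leRHS]/(0%:E) -an0 -aN.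
    by apply: le_measure; rewrite ?inE//; exact: measurableI.
  rewrite mulrC; apply: integral_exponential_on => //.
  - by apply: lam_gt0; apply: leq_trans (ltn_ord i) _.
  - by move=> t t0; apply: tail => //; rewrite -ltnS.
rewrite (@esum_fin_support _ _ (index_iota 0 k)) ?iota_uniq//.
- by rewrite sumEFin sum_a_inv.
- move=> n; rewrite lee_fin; case: (ltnP n k) => nk; last by rewrite /a ltnNge nk mulr0.
  rewrite mulr_ge0// sumr_ge0// => i _; rewrite invr_ge0 ltW// lam_gt0//.
  exact: leq_trans (ltn_ord i) _.
- by move=> n; rewrite mem_index_iota/= -leqNgt /a ltnNge => ->; rewrite mulr0.
Qed.

End ModelMeans.
(** * The theorem *)

Section CoxCharacterization.
Context {R : realType}.
Variables (k : nat) (hk : (0 < k)%N) (lam q : nat -> R) (mu : R) (b : nat).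
Variable p : nat -> R.
Hypothesis hpar : cox_batch_params k lam q mu b p.
Let rate := cox_rate (k := k) lam q mu b p.
Let o : 'I_k := Ordinal hk.

Let level g (x : nat * 'I_k) : R :=
  cox_level lam q mu b p g (cox_pi0 k lam q mu b p g) x.1 x.2.

Let unique := stationary_unique (cox_rate_ge0 hk hpar) (cox_exit_sum hk hpar)
  (cox_exit_lo_gt0 hk hpar) (cox_exit_bounds hk hpar) (cox_connected hk hpar).

Lemma cox_level00 g c : cox_level lam q mu b p g c 0 0 = c.
Proof.
rewrite /cox_level !big_geq// addr0 !mulr1 divff ?mulr1//.
by rewrite gt_eqF// (cox_lam_gt0 hpar).
Qed.

(* The stationary distribution determines [g] as the ratio of the probabilities
   of levels 2 and 1. *)
Lemma cox_root_unique g g' : 0 < g < 1 -> g = coxF k lam q mu b p g ->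
  0 < g' < 1 -> g' = coxF k lam q mu b p g' -> g = g'.
Proof.
move=> g01 gF g01' gF'.
have pis := cox_stationary hk hpar g01 gF.
have := unique pis (cox_stationary hk hpar g01' gF') => e.
have level2 h c : cox_level lam q mu b p h c 2 0 = h * cox_level lam q mu b p h c 1 0.
  by rewrite /cox_level expr1 expr0; ring.
have e1 : level g (1%N, o) = level g' (1%N, o) by have := congr1 (fun f => f (1%N, o)) e.
have e2 : level g (2%N, o) = level g' (2%N, o) by have := congr1 (fun f => f (2%N, o)) e.
have l0 : level g (1%N, o) != 0.
  rewrite gt_eqF//; exact: (stationary_gt0 (cox_rate_ge0 hk hpar)
    (cox_exit_lo_gt0 hk hpar) (cox_exit_bounds hk hpar) (cox_connected hk hpar) _ pis).
apply: (mulIf l0); rewrite [in RHS]e1.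
by rewrite -[LHS]level2 -[RHS]level2.
Qed.

Lemma cox_stationaryP g pi : 0 < g < 1 -> g = coxF k lam q mu b p g ->
  stationary_distribution rate pi <-> pi = level g.
Proof.
move=> g01 gF; have pis := cox_stationary hk hpar g01 gF.
by split => [/unique/(_ pis)|->].
Qed.

End CoxCharacterization.

Section CoxErgodic.
Context {R : realType} {d : measure_display} {T : measurableType d}.
Variables (k : nat) (hk : (0 < k)%N) (lam q : nat -> R) (mu : R) (b : nat).
Variable p : nat -> R.
Hypothesis hpar : cox_batch_params k lam q mu b p.
Variables (P : nat * 'I_k -> probability T R).
Variables (X : nat -> T -> nat * 'I_k) (H : nat -> T -> R).
Hypothesis hX : forall x, markov_jump_process (cox_rate lam q mu b p) (P x) X H x.

Lemma cox_ergodicP :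
  ergodic P X H <-> 1 / mean_interarrival k lam q < mu * mean_batch b p.
Proof.
have rate0 := cox_rate_ge0 hk hpar.
have exits := cox_exit_sum hk hpar.
have lo := cox_exit_lo_gt0 hk hpar.
have bounds := cox_exit_bounds hk hpar.
have conn := cox_connected hk hpar.
have recP x := integral_return_time_lty (jump_prob_ge0 rate0 lo bounds)
  (exit_rate_gt0 lo bounds) (hX x) lo bounds.
split=> [[_ /(_ (0%N, Ordinal hk)) /(recP _).1 W]|].
  have [pi pis] := taboo_stationary rate0 exits lo bounds W.
  exact: (cox_drift hk hpar pis).
move=> /(cox_root hk hpar)[g [g01 gF]].
have pis := cox_stationary hk hpar g01 gF; split.
  exact: irreducible_of_connected (exit_rate_gt0 lo bounds) hX conn.
move=> x; apply/(recP x).2; apply: (stationary_taboo rate0 lo bounds pis).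
exact: (stationary_gt0 rate0 lo bounds conn _ pis).
Qed.

End CoxErgodic.

Unset Implicit Arguments.

Theorem theorem4p1 (R : realType) (k : nat) (hk : (0 < k)%N) (lam q : nat -> R) (mu : R)
    (b : nat) (p : nat -> R)
    (hpar : cox_batch_params k lam q mu b p)
    (* an inter-arrival time and a batch size *)
    (dA : measure_display) (TA : measurableType dA) (PA : probability TA R)
    (C : TA -> R) (Y : TA -> nat)
    (hC : coxian k lam q PA C) (hY : batch_size b p PA Y)
    (* the queue-length process, under each initial state *)
    (d : measure_display) (T : measurableType d)
    (P : nat * 'I_k -> probability T R)
    (X : nat -> T -> nat * 'I_k) (H : nat -> T -> R)
    (hX : forall x, markov_jump_process (cox_rate lam q mu b p) (P x) X H x) :
  let o : 'I_k := Ordinal hk in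
  let phi := phiY b p in
  let F := coxF k lam q mu b p in
  let EC := mean_interarrival k lam q in
  let EY := mean_batch b p in
  [/\ ('E_PA[C] = EC%:E /\ 'E_PA[fun w => (Y w)%:R] = EY%:E)%E,
      ergodic P X H <-> 1 / EC < mu * EY
    & ergodic P X H ->
      (exists! g : R, 0 < g < 1 /\ g = F g) /\
      forall g : R, 0 < g < 1 -> g = F g ->
      let al := alpha lam mu b p g in
      forall pi : nat * 'I_k -> R,
        stationary_distribution (cox_rate lam q mu b p) pi <->
        [/\ forall (m : nat) (i : 'I_k), (1 <= m)%N ->
              pi (m, i) = pi (0%N, o)
                * (lam 0%N * (1 - g) * g ^+ m.-1 / (mu * (1 - phi g)))
                * \prod_(1 <= l < i.+1) (q l.-1 * al l),
            (* The sum carries the coefficient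
               (1 - g) / (1 - phi g) * \sum_(m >= 1) g ^+ (m - 1) P(Y >= m) = 1.
               The source prints (1 - g) phi(g) / (g (1 - phi g)) here, which is
               what P(Y = m) in place of P(Y >= m) would give; with it the
               balance equations fail unless k = 1 or Y = 1 almost surely. *)
            forall i : 'I_k, (1 <= i)%N ->
              pi (0%N, i) = pi (0%N, o)
                * (lam 0%N / lam i) * (\prod_(0 <= s < i) q s)
                * (1 + \sum_(1 <= j < i.+1) \prod_(1 <= l < j.+1) al l)
          & pi (0%N, o) =
              ((1 + lam 0%N / (mu * (1 - phi g)))
               * (1 + \sum_(1 <= i < k)
                        lam 0%N / lam i * \prod_(0 <= j < i) q j))^-1]].
Proof.
move=> o phi F EC EY; have ergP := cox_ergodicP hk hpar hX.
split=> //.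
  split; last by case: hpar => _ _ _ _ [p0 p1]; exact: batch_size_mean.
  apply: coxian_mean hC => //.
  - exact: (cox_lam_gt0 hpar).
  - exact: (cox_q_bounds hpar).
  - by case: hpar.
move=> /ergP.1 drift; split.
  have [g [g01 gF]] := cox_root hk hpar drift.
  exists g; split=> // g' [g01' gF'].
  exact: (cox_root_unique hk hpar g01 gF g01' gF').
move=> g g01 gF al pi; rewrite (cox_stationaryP hk hpar pi g01 gF).
have level0 c : cox_level lam q mu b p g c 0 o = c := cox_level00 hk hpar g c.
split=> [->|[up boundary top]].
  by split=> [[//|m] i _|i i0|] /=; rewrite level0.
apply/funext => -[[|m] i] /=; last by rewrite up// top.
(* The remaining state [(0, o)] is covered by [top], since there the boundary formula reduces to
   [c]. *)
case: (posnP i) => [i0|i0]; last by rewrite boundary// top.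
by rewrite (_ : i = o) ?level0//; exact: val_inj.
Qed.
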